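(* Let $\phi$ be a parabolic linear fractional map with $\phi(\mathbb{D})\subset\mathbb{D}$ which is not an automorphism of $\mathbb{D}$. Then for every $\lambda\in\mathbb{C}$ and every $\nu\in\mathbb{R}$, the operator $\lambda C_\phi$ is not recurrent on $\mathcal{S}_\nu$.
   Context: $\mathbb{D}$ is the open unit disk of $\mathbb{C}$. For $\nu\in\mathbb{R}$, the weighted Dirichlet space $\mathcal{S}_\nu$ is the Hilbert space of analytic functions $f(z)=\sum_{n\ge 0}a_nz^n$ on $\mathbb{D}$ with $\|f\|_\nu^2=\sum_{n\ge0}|a_n|^2(n+1)^{2\nu}<\infty$. For a self-map $\phi$ of $\mathbb{D}$, $C_\phi f=f\circ\phi$; it is known that $C_\phi$ is bounded on every $\mathcal{S}_\nu$ when $\phi$ is a linear fractional self-map of $\mathbb{D}$. A bounded linear operator $T$ on a Hilbert space $\mathcal{H}$ is recurrent if for every non-empty open $U\subset\mathcal{H}$ there is a positive integer $n$ with $T^n(U)\cap U\neq\emptyset$. A linear fractional map ($\phi(z)=\frac{az+b}{cz+d}$, $ad-bc\ne0$) other than the identity is parabolic if it has only one fixed point in $\hat{\mathbb{C}}=\mathbb{C}\cup\{\infty\}$; for a self-map of $\mathbb{D}$ this fixed point lies on the unit circle. *)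

(* Defs.v *)
From Stdlib Require Import Reals ClassicalEpsilon.
From Coquelicot Require Import Coquelicot.

Open Scope R_scope.

Definition disk (z : C) : Prop := Cmod z < 1.

(** * Linear fractional maps *)

(** The Riemann sphere: [None] is the point at infinity. *)
Definition sphere : Type := option C.

Definition linear_fractional (a b c d : C) (w : sphere) : sphere :=
  match w with
  | Some z =>
      if Ceq_dec (c * z + d)%C 0 then None
      else Some ((a * z + b) / (c * z + d))%C
  | None =>
      if Ceq_dec c 0 then None
      else Some (a / c)%C
  end.

Definition is_linear_fractional (phi : sphere -> sphere) : Prop :=
  exists a b c d : C,
    (a * d - b * c)%C <> RtoC 0 /\
    forall w, phi w = linear_fractional a b c d w.

Definition parabolic (phi : sphere -> sphere) : Prop :=
  is_linear_fractional phi /\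
  ~ (forall w, phi w = w) /\
  exists! w : sphere, phi w = w.

Definition disk_self_map (phi : sphere -> sphere) : Prop :=
  forall z, disk z -> exists w, disk w /\ phi (Some z) = Some w.

(** Only used for linear fractional [phi]: there analyticity of [phi] and of
    its inverse is automatic, so that bijectivity on the disk suffices. *)
Definition disk_automorphism (phi : sphere -> sphere) : Prop :=
  disk_self_map phi /\
  (forall z1 z2, disk z1 -> disk z2 ->
     phi (Some z1) = phi (Some z2) -> z1 = z2) /\
  (forall w, disk w -> exists z, disk z /\ phi (Some z) = Some w).

(** * Weighted Dirichlet spaces

    An analytic function on the disk is represented by a total function
    [C -> C] whose values outside the disk are irrelevant: functions that agree
    on the disk are at distance 0, hence lie in the same open sets. *)

Definition taylor_series (f : C -> C) (a : nat -> C) : Prop :=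
  forall z, disk z -> is_pseries (K := C_AbsRing) (V := C_NormedModule) a z (f z).

Definition analytic_on_disk (f : C -> C) : Prop :=
  exists a, taylor_series f a.

(** The coefficients are unique for [f] analytic on the disk, and unspecified
    otherwise. *)
Definition taylor_coef (f : C -> C) : nat -> C :=
  epsilon (inhabits (fun _ => RtoC 0)) (taylor_series f).

Definition dirichlet_term (nu : R) (f : C -> C) (n : nat) : R :=
  Cmod (taylor_coef f n) ^ 2 * Rpower (INR n + 1) (2 * nu).

Definition dirichlet_space (nu : R) (f : C -> C) : Prop :=
  analytic_on_disk f /\ ex_series (dirichlet_term nu f).

Definition dirichlet_norm (nu : R) (f : C -> C) : R :=
  sqrt (Series (dirichlet_term nu f)).

Definition dirichlet_open (nu : R) (U : (C -> C) -> Prop) : Prop :=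
  (forall f, U f -> dirichlet_space nu f) /\
  forall f, U f -> exists eps : R, 0 < eps /\
    forall g, dirichlet_space nu g ->
      dirichlet_norm nu (fun z => (g z - f z)%C) < eps -> U g.

(** * Recurrence *)

Definition composition_operator (phi : sphere -> sphere) (f : C -> C) : C -> C :=
  fun z => match phi (Some z) with Some w => f w | None => RtoC 0 end.

Definition scaled (lambda : C) (T : (C -> C) -> C -> C) (f : C -> C) : C -> C :=
  fun z => (lambda * T f z)%C.

Definition recurrent (nu : R) (T : (C -> C) -> C -> C) : Prop :=
  forall U : (C -> C) -> Prop,
    dirichlet_open nu U -> (exists f, U f) ->
    exists n : nat, (0 < n)%nat /\ exists f, U f /\ U (Nat.iter n T f).

(* Main.v *)
(* In the coordinate s = (zeta + z) / (zeta - z), zeta being the fixed point, phi is the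
   translation s -> s + a of the right half-plane, and Re a > 0 because phi is not an
   automorphism. With F(s) = f(z) and a large integer k, consider the functional
     L(f) = integral over Re s = 1 of F(s) exp(t s) / (s - 3)^k.
   In S_nu functions grow polynomially, so L is continuous. Since (lambda C_phi)^n f is
   lambda^n F(s + n a), moving the line of integration to Re s = 1 - n Re a gains the factor
   exp(- t n Re a), which beats |lambda|^n for large t: L((lambda C_phi)^n f) tends to 0
   uniformly for f in a bounded set. On the other hand L does not vanish on the function
   1 / (s + 1), a polynomial in z, so orbits cannot return close to it for large n; for small n
   this is seen from point evaluations, because 1 / (s + 1) is not periodic. So
   that real integrals on compact intervals suffice, L is replaced by the real part of the
   integral over |Im s| <= r, with r tending to infinity, and F by its Taylor polynomials
   in z. *)

Require Import Defs.
From Stdlib Require Import Reals Lra Lia Psatz ClassicalEpsilon FunctionalExtensionality.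
From Coquelicot Require Import Coquelicot.

(** The delicate point is that L must not vanish on 1 / (s + 1) for the particular t that lambda
    dictates. By residues, the integral in y of exp(t s) / ((s + 1) (s - 3)^k) over s = 1 + i y is 2
    pi exp(-t) / (-4)^k, since -1 is the only pole to the left of the line. The residue theorem is
    replaced by two elementary facts, each valid up to O(1/r): exp(t) times the truncated integral
    does not depend on t, and at t = 0 passing from k to k + 1 divides it by -4. The case k = 1, t =
    0 is an arctangent, because (s + 1) (s - 3) = -(4 + y^2) on the line. This is the reason for the
    pole 3, the mirror image of -1 in the line; lying to the right, it never obstructs a shift to
    the left. Point evaluations cannot replace L for large n, because lambda^n F(s + n a) need not
    become small when |lambda| > 1. The gain exp(-t n Re a) must also beat a factor polynomial in n,
    which comes from the growth of F at height n Im a. *)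

Lemma Re_nonzero (z : C) : Re z <> 0 -> z <> RtoC 0.
Proof. intros H E; apply H; now rewrite E. Qed.

Lemma exp_le (a b : R) : a <= b -> exp a <= exp b.
Proof. intros [H|H]; [left; now apply exp_increasing|right; now rewrite H]. Qed.

Lemma im_le_Cmod (z : C) : Rabs (Im z) <= Cmod z.
Proof. eapply Rle_trans; [apply Rmax_r|apply Rmax_Cmod]. Qed.

Lemma Cmod_triangle_abs (x y : R) : Cmod (x, y) <= Rabs x + Rabs y.
Proof.
  replace (x, y) with (RtoC x + Ci * RtoC y)%C by (apply injective_projections; simpl; ring).
  eapply Rle_trans; [apply Cmod_triangle|].
  rewrite Cmod_mult, Cmod_Ci, !Cmod_R; lra.
Qed.

Lemma one_plus_le_exp x : 1 + x <= exp x.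
Proof.
  destruct (Req_dec x 0) as [->|H]; [rewrite exp_0; lra|left; now apply exp_ineq1].
Qed.

Lemma exp_mult_INR x n : exp (x * INR n) = exp x ^ n.
Proof.
  induction n as [|n IH]; [now rewrite Rmult_0_r, exp_0|].
  rewrite S_INR, Rmult_plus_distr_l, exp_plus, IH, Rmult_1_r; simpl; ring.
Qed.

Lemma is_RInt_inv_4_sqr r : is_RInt (fun y => / (4 + y ^ 2)) (- r) r (atan (r / 2)).
Proof.
  replace (atan (r / 2)) with (minus (/ 2 * atan (r / 2)) (/ 2 * atan (- r / 2))).
  2: { unfold minus, plus, opp; simpl.
       replace (- r / 2) with (- (r / 2)) by field. rewrite atan_opp; field. }
  apply (is_RInt_derive (fun y => / 2 * atan (y / 2))).
  - intros y _. auto_derive; trivial. field; nra.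
  - intros y _. apply (ex_derive_continuous (fun y => / (4 + y ^ 2))).
    auto_derive. nra.
Qed.

(** The bound does not depend on [r], so it survives when [r] tends to infinity; 2 is a crude upper
    bound for pi / 2. *)
Lemma RInt_le_inv_4_sqr (g : R -> R) r c :
  0 <= r -> 0 <= c -> ex_RInt g (- r) r ->
  (forall y, - r <= y <= r -> Rabs (g y) <= c * / (4 + y ^ 2)) ->
  Rabs (RInt g (- r) r) <= 2 * c.
Proof.
  intros Hr Hc Hg H.
  apply Rle_trans with (c * atan (r / 2)).
  - apply (norm_RInt_le g (fun y => c * / (4 + y ^ 2)) (- r) r); [lra|exact H| |].
    + apply (RInt_correct (V := R_CompleteNormedModule)), Hg.
    + apply (is_RInt_scal (V := R_NormedModule)), is_RInt_inv_4_sqr.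
  - rewrite (Rmult_comm 2). apply Rmult_le_compat_l; [exact Hc|].
    pose proof (atan_bound (r / 2)); pose proof PI_4; lra.
Qed.

(** * Holomorphic functions on vertical strips *)

(** Joint continuity in two real variables is the form required for differentiation under the
    integral sign. *)
Definition continuous_2d (G : C -> C) (x y : R) : Prop :=
  continuity_2d_pt (fun a b => Re (G (a, b))) x y /\
  continuity_2d_pt (fun a b => Im (G (a, b))) x y.

Definition cauchy_riemann (G G' : C -> C) (x y : R) : Prop :=
  is_derive (fun a => Re (G (a, y))) x (Re (G' (x, y))) /\
  is_derive (fun a => Im (G (a, y))) x (Im (G' (x, y))) /\
  is_derive (fun b => Re (G (x, b))) y (- Im (G' (x, y))) /\
  is_derive (fun b => Im (G (x, b))) y (Re (G' (x, y))).

(** Continuity of the derivative is built in, so that contour shifts follow from differentiation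
    under the integral sign, without Goursat's theorem. *)
Definition holomorphic_strip (xa xb : R) (G : C -> C) : Prop :=
  exists G' : C -> C, forall x y, xa < x < xb ->
    continuous_2d G x y /\ continuous_2d G' x y /\ cauchy_riemann G G' x y.

Lemma continuous_2d_mult G H x y :
  continuous_2d G x y -> continuous_2d H x y ->
  continuous_2d (fun s => G s * H s)%C x y.
Proof.
  intros [G1 G2] [H1 H2]; split; simpl.
  - apply continuity_2d_pt_minus; apply continuity_2d_pt_mult; assumption.
  - apply continuity_2d_pt_plus; apply continuity_2d_pt_mult; assumption.
Qed.

Lemma continuous_2d_plus G H x y :
  continuous_2d G x y -> continuous_2d H x y ->
  continuous_2d (fun s => G s + H s)%C x y.
Proof.
  intros [G1 G2] [H1 H2]; split; simpl; apply continuity_2d_pt_plus; assumption.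
Qed.

Lemma is_derive_re_mult (a b c d : R -> R) x a' b' c' d' :
  is_derive a x a' -> is_derive b x b' -> is_derive c x c' -> is_derive d x d' ->
  is_derive (fun x => a x * b x - c x * d x) x
    ((a' * b x + a x * b') - (c' * d x + c x * d')).
Proof.
  intros Ha Hb Hc Hd.
  apply (is_derive_minus (V := R_NormedModule) (fun x => a x * b x) (fun x => c x * d x));
    apply (is_derive_mult (K := R_AbsRing)); try assumption; apply Rmult_comm.
Qed.

Lemma is_derive_im_mult (a b c d : R -> R) x a' b' c' d' :
  is_derive a x a' -> is_derive b x b' -> is_derive c x c' -> is_derive d x d' ->
  is_derive (fun x => a x * b x + c x * d x) x
    ((a' * b x + a x * b') + (c' * d x + c x * d')).
Proof.
  intros Ha Hb Hc Hd.
  apply (is_derive_plus (V := R_NormedModule) (fun x => a x * b x) (fun x => c x * d x));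
    apply (is_derive_mult (K := R_AbsRing)); try assumption; apply Rmult_comm.
Qed.

Lemma holomorphic_strip_mult xa xb G H :
  holomorphic_strip xa xb G -> holomorphic_strip xa xb H ->
  holomorphic_strip xa xb (fun s => G s * H s)%C.
Proof.
  intros [G' HG] [H' HH].
  exists (fun s => G' s * H s + G s * H' s)%C; intros x y Hx.
  destruct (HG x y Hx) as [cG [cG' [Ga [Gb [Gc Gd]]]]].
  destruct (HH x y Hx) as [cH [cH' [Ha [Hb [Hc Hd]]]]].
  split; [now apply continuous_2d_mult|split].
  { apply (continuous_2d_plus (fun s => G' s * H s)%C (fun s => G s * H' s)%C);
      apply continuous_2d_mult; assumption. }
  refine (conj _ (conj _ (conj _ _))); simpl.
  - evar_last; [apply is_derive_re_mult; eassumption|unfold Re, Im; simpl; ring].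
  - evar_last; [apply is_derive_im_mult; eassumption|unfold Re, Im; simpl; ring].
  - evar_last; [apply is_derive_re_mult; eassumption|unfold Re, Im; simpl; ring].
  - evar_last; [apply is_derive_im_mult; eassumption|unfold Re, Im; simpl; ring].
Qed.

Lemma holomorphic_strip_plus xa xb G H :
  holomorphic_strip xa xb G -> holomorphic_strip xa xb H ->
  holomorphic_strip xa xb (fun s => G s + H s)%C.
Proof.
  intros [G' HG] [H' HH].
  exists (fun s => G' s + H' s)%C; intros x y Hx.
  destruct (HG x y Hx) as [cG [cG' [Ga [Gb [Gc Gd]]]]].
  destruct (HH x y Hx) as [cH [cH' [Ha [Hb [Hc Hd]]]]].
  split; [now apply continuous_2d_plus|split; [now apply continuous_2d_plus|]].
  refine (conj _ (conj _ (conj _ _))); simpl.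
  - apply (is_derive_plus (V := R_NormedModule)); assumption.
  - apply (is_derive_plus (V := R_NormedModule)); assumption.
  - evar_last; [apply (is_derive_plus (V := R_NormedModule)); eassumption|].
    unfold plus, Im; simpl; ring.
  - apply (is_derive_plus (V := R_NormedModule)); assumption.
Qed.

Lemma continuous_2d_const (c : C) x y : continuous_2d (fun _ => c) x y.
Proof. split; apply continuity_2d_pt_const. Qed.

Lemma holomorphic_strip_const xa xb (c : C) : holomorphic_strip xa xb (fun _ => c).
Proof.
  exists (fun _ => RtoC 0); intros x y _.
  split; [apply continuous_2d_const|split; [apply continuous_2d_const|]].
  refine (conj _ (conj _ (conj _ _))); simpl; rewrite ?Ropp_0; apply @is_derive_const.
Qed.

Lemma continuous_2d_inv_shift (c : C) x y :
  ((x, y) + c)%C <> RtoC 0 -> continuous_2d (fun s => / (s + c))%C x y.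
Proof.
  intros Hne.
  assert (Hpos : (x + fst c) ^ 2 + (y + snd c) ^ 2 <> 0).
  { intros E; apply Hne, Cmod_eq_0; destruct c as [c1 c2].
    unfold Cmod; simpl fst in *; simpl snd in *; rewrite E; apply sqrt_0. }
  assert (H1 : continuity_2d_pt (fun a b => a + fst c) x y).
  { apply continuity_2d_pt_plus; [apply continuity_2d_pt_id1|apply continuity_2d_pt_const]. }
  assert (H2 : continuity_2d_pt (fun a b => b + snd c) x y).
  { apply continuity_2d_pt_plus; [apply continuity_2d_pt_id2|apply continuity_2d_pt_const]. }
  assert (H3 : continuity_2d_pt (fun a b => / ((a + fst c) ^ 2 + (b + snd c) ^ 2)) x y).
  { apply continuity_2d_pt_inv; [|exact Hpos]. simpl.
    apply continuity_2d_pt_plus; repeat apply continuity_2d_pt_mult;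
      try assumption; apply continuity_2d_pt_const. }
  split; unfold Cinv; simpl; unfold Rdiv; apply continuity_2d_pt_mult; try assumption.
  apply continuity_2d_pt_opp; assumption.
Qed.

Lemma holomorphic_strip_inv_shift xa xb (c : C) :
  (forall x y, xa < x < xb -> ((x, y) + c)%C <> RtoC 0) ->
  holomorphic_strip xa xb (fun s => / (s + c))%C.
Proof.
  intros Hne.
  exists (fun s => - (1) * (/ (s + c) * / (s + c)))%C; intros x y Hx.
  specialize (Hne x y Hx).
  split; [now apply continuous_2d_inv_shift|split].
  { apply (continuous_2d_mult (fun _ => - (1))%C); [apply continuous_2d_const|].
    apply (continuous_2d_mult (fun s => / (s + c))%C (fun s => / (s + c))%C);
      now apply continuous_2d_inv_shift. }
  assert (Hpos : (x + fst c) ^ 2 + (y + snd c) ^ 2 <> 0).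
  { intros E; apply Hne, Cmod_eq_0; destruct c as [c1 c2].
    unfold Cmod; simpl fst in *; simpl snd in *; rewrite E; apply sqrt_0. }
  destruct c as [c1 c2]; unfold cauchy_riemann, Re, Im; simpl in *.
  refine (conj _ (conj _ (conj _ _))); auto_derive; try (intros E; apply Hpos; lra);
    field; intros E; apply Hpos; lra.
Qed.

(* [exp (t s)], with [t] real. *)
Definition exp_scaled (t : R) (s : C) : C :=
  (exp (t * Re s) * cos (t * Im s), exp (t * Re s) * sin (t * Im s)).

Lemma Cmod_exp_scaled t s : Cmod (exp_scaled t s) = exp (t * Re s).
Proof.
  unfold Cmod, exp_scaled; simpl fst; simpl snd.
  replace (_ + _) with (exp (t * Re s) * exp (t * Re s)).
  - apply sqrt_square; left; apply exp_pos.
  - pose proof (sin2_cos2 (t * Im s)) as E; unfold Rsqr in E.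
    transitivity (exp (t * Re s) * exp (t * Re s) *
      (sin (t * Im s) * sin (t * Im s) + cos (t * Im s) * cos (t * Im s)));
      [rewrite E|]; ring.
Qed.

Lemma continuous_2d_exp_scaled t x y : continuous_2d (exp_scaled t) x y.
Proof.
  assert (Hx : continuity_2d_pt (fun a b => t * a) x y).
  { apply continuity_2d_pt_mult; [apply continuity_2d_pt_const|apply continuity_2d_pt_id1]. }
  assert (Hy : continuity_2d_pt (fun a b => t * b) x y).
  { apply continuity_2d_pt_mult; [apply continuity_2d_pt_const|apply continuity_2d_pt_id2]. }
  split; simpl; apply continuity_2d_pt_mult.
  - apply (continuity_1d_2d_pt_comp exp); [|exact Hx].
    apply derivable_continuous_pt, derivable_pt_exp.
  - apply (continuity_1d_2d_pt_comp cos); [apply continuity_cos|exact Hy].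
  - apply (continuity_1d_2d_pt_comp exp); [|exact Hx].
    apply derivable_continuous_pt, derivable_pt_exp.
  - apply (continuity_1d_2d_pt_comp sin); [apply continuity_sin|exact Hy].
Qed.

Lemma holomorphic_strip_exp_scaled xa xb t : holomorphic_strip xa xb (exp_scaled t).
Proof.
  exists (fun s => RtoC t * exp_scaled t s)%C; intros x y _.
  split; [apply continuous_2d_exp_scaled|split].
  { apply (continuous_2d_mult (fun _ => RtoC t));
      [apply continuous_2d_const|apply continuous_2d_exp_scaled]. }
  unfold cauchy_riemann, exp_scaled, Re, Im; simpl.
  refine (conj _ (conj _ (conj _ _))); auto_derive; trivial; ring.
Qed.

Lemma holomorphic_strip_pow xa xb G n :
  holomorphic_strip xa xb G -> holomorphic_strip xa xb (fun s => G s ^ n)%C.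
Proof.
  intros HG; induction n as [|n IH]; simpl.
  - apply holomorphic_strip_const.
  - now apply holomorphic_strip_mult.
Qed.

Lemma holomorphic_strip_sum xa xb (F : nat -> C -> C) n :
  (forall k, holomorphic_strip xa xb (F k)) ->
  holomorphic_strip xa xb (fun s => sum_n (fun k => F k s) n).
Proof.
  intros HF; induction n as [|n [G' IH]].
  - destruct (HF O) as [G' HG]. exists G'; intros x y Hx.
    destruct (HG x y Hx) as [A B].
    replace (fun s => sum_n (fun k => F k s) 0) with (F O); [auto|].
    apply functional_extensionality; intros s; now rewrite sum_O.
  - replace (fun s => sum_n (fun k => F k s) (S n)) with
      (fun s => sum_n (fun k => F k s) n + F (S n) s)%C.
    + apply holomorphic_strip_plus; [now exists G'|apply HF].
    + apply functional_extensionality; intros s; now rewrite sum_Sn.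
Qed.

Lemma holomorphic_strip_ex_RInt xa xb G x a b :
  holomorphic_strip xa xb G -> xa < x < xb ->
  ex_RInt (fun y => Re (G (x, y))) a b.
Proof.
  intros [G' HG] Hx; apply (ex_RInt_continuous (V := R_CompleteNormedModule)).
  intros y _; apply (ex_derive_continuous (fun y => Re (G (x, y)))).
  destruct (HG x y Hx) as [_ [_ [_ [_ [H _]]]]].
  eexists; exact H.
Qed.

Lemma continuity_2d_snd (f : R -> R -> R) x y :
  continuity_2d_pt f x y -> continuous (f x) y.
Proof.
  intros H P [eps HP].
  destruct (H eps) as [d Hd]. exists d; intros z Hz.
  apply HP, Hd; [|exact Hz].
  rewrite Rminus_eq_0, Rabs_R0; apply cond_pos.
Qed.

(** Mean value theorem for an integral depending on a parameter. The hypothesis bounds the integral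
    of [w] rather than [w] itself, because both applications live from cancellation inside that
    integral. The parameter is the abscissa of the line in one of them and the exponent t in the
    other. *)
Lemma RInt_param_increment (u w : R -> R -> R) xa xb x0 x1 a b M :
  xa < x0 -> x0 <= x1 -> x1 < xb -> a <= b ->
  (forall x y, xa < x < xb -> is_derive (fun x => u x y) x (w x y)) ->
  (forall x y, xa < x < xb -> continuity_2d_pt w x y) ->
  (forall x, xa < x < xb -> ex_RInt (u x) a b) ->
  (forall x, x0 <= x <= x1 -> Rabs (RInt (w x) a b) <= M) ->
  Rabs (RInt (u x1) a b - RInt (u x0) a b) <= M * (x1 - x0).
Proof.
  intros H0 H01 H1 Hab Hd Hc Hi HM.
  assert (Hloc : forall x, xa < x < xb -> locally x (fun z => xa < z < xb)).
  { intros x Hx.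
    apply (open_and (fun z => xa < z) (fun z => z < xb)); [apply open_gt|apply open_lt|exact Hx]. }
  assert (HD : forall x, xa < x < xb ->
            is_derive (fun x => RInt (u x) a b) x (RInt (w x) a b)).
  { intros x Hx.
    assert (E : forall t, Derive (fun z => u z t) x = w x t).
    { intros t; apply is_derive_unique, Hd, Hx. }
    evar_last.
    - apply (is_derive_RInt_param u a b x).
      + apply (filter_imp (fun z => xa < z < xb)); [|now apply Hloc].
        intros z Hz t _; eexists; now apply Hd.
      + intros t _.
        apply (continuity_2d_pt_ext_loc w); [|now apply Hc].
        destruct (Hloc x Hx) as [d Hdd]. exists d; intros p q Hp _.
        symmetry; apply is_derive_unique, Hd, Hdd, Hp.
      + apply (filter_imp (fun z => xa < z < xb)); [|now apply Hloc].
        intros z Hz; now apply Hi.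
    - apply RInt_ext; intros t _; apply E. }
  destruct (MVT_gen (fun x => RInt (u x) a b) x0 x1 (fun x => RInt (w x) a b)) as [c [Hcc Ec]].
  - rewrite Rmin_left, Rmax_right by lra. intros x Hx; apply HD; lra.
  - rewrite Rmin_left, Rmax_right by lra. intros x Hx.
    apply continuity_pt_filterlim, (ex_derive_continuous (fun x => RInt (u x) a b)).
    eexists; apply HD; lra.
  - rewrite Rmin_left, Rmax_right in Hcc by lra.
    rewrite Ec, Rabs_mult, (Rabs_right (x1 - x0)) by lra.
    apply Rmult_le_compat_r; [lra|now apply HM].
Qed.

(* By the Cauchy-Riemann equations, the derivative in [x] of the integral is the difference of
   [Im G] at the two ends. *)
Lemma vertical_line_shift xa xb G x0 x1 r M :
  holomorphic_strip xa xb G ->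
  xa < x0 -> x0 <= x1 -> x1 < xb -> 0 <= r ->
  (forall x, x0 <= x <= x1 -> Cmod (G (x, r)) <= M /\ Cmod (G (x, - r)) <= M) ->
  Rabs (RInt (fun y => Re (G (x1, y))) (- r) r - RInt (fun y => Re (G (x0, y))) (- r) r)
    <= 2 * M * (x1 - x0).
Proof.
  intros HG H0 H01 H1 Hr HM.
  pose proof HG as [G' HG'].
  apply (RInt_param_increment (fun x y => Re (G (x, y))) (fun x y => Re (G' (x, y))) xa xb);
    try lra.
  - intros x y Hx; apply HG', Hx.
  - intros x y Hx; apply HG', Hx.
  - intros x Hx; now apply (holomorphic_strip_ex_RInt xa xb).
  - intros x Hx.
    assert (E : is_RInt (fun y => Re (G' (x, y))) (- r) r
               (minus (Im (G (x, r))) (Im (G (x, - r))))).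
    { apply (is_RInt_derive (fun y => Im (G (x, y)))).
      - intros y _; apply HG'; lra.
      - intros y _; apply (continuity_2d_snd (fun x y => Re (G' (x, y)))), HG'; lra. }
    rewrite (is_RInt_unique _ _ _ _ E).
    destruct (HM x Hx) as [A B].
    unfold minus, plus, opp; simpl.
    eapply Rle_trans; [apply Rabs_triang|].
    rewrite Rabs_Ropp.
    pose proof (im_le_Cmod (G (x, r))); pose proof (im_le_Cmod (G (x, - r))); lra.
Qed.

(** * The integral kernel *)

Definition kernel (t : R) (k : nat) (s : C) : C :=
  (exp_scaled t s * (/ (s + RtoC (-3))) ^ k)%C.

Lemma holomorphic_strip_kernel xa xb t k :
  xb <= 3 -> holomorphic_strip xa xb (kernel t k).
Proof.
  intros Hb; apply holomorphic_strip_mult; [apply holomorphic_strip_exp_scaled|].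
  apply holomorphic_strip_pow, holomorphic_strip_inv_shift.
  intros x y Hx; apply Re_nonzero; simpl; lra.
Qed.

Lemma Cmod_kernel_le t k s r :
  0 < r -> r <= Cmod (s + RtoC (-3)) -> Cmod (kernel t k s) <= exp (t * Re s) / r ^ k.
Proof.
  intros Hr Hs; unfold kernel.
  assert (Hne : (s + RtoC (-3))%C <> RtoC 0) by (apply Cmod_gt_0; lra).
  unfold Rdiv; rewrite Cmod_mult, Cmod_exp_scaled, Cmod_pow, Cmod_inv, <- pow_inv by exact Hne.
  apply Rmult_le_compat_l; [left; apply exp_pos|].
  apply pow_incr; split; [left; apply Rinv_0_lt_compat; lra|].
  apply Rinv_le_contravar; assumption.
Qed.

(** The line is moved to Re s = -r. On the three other sides of the rectangle |s - 3| >= r and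
    |exp(t s)| <= exp t, so the kernel is at most exp t / r^2 there, and their total length 4 r + 2
    is at most 6 r. *)
Lemma kernel_integral_le t k r :
  0 <= t -> (2 <= k)%nat -> 1 <= r ->
  Rabs (RInt (fun y => Re (kernel t k (1, y))) (- r) r) <= 6 * exp t / r.
Proof.
  intros Ht Hk Hr.
  assert (Hb : forall s, Re s <= 1 -> r <= Cmod (s + RtoC (-3)) ->
            Cmod (kernel t k s) <= exp t / r ^ 2).
  { intros s Hs Hm. eapply Rle_trans; [apply (Cmod_kernel_le t k s r); lra|].
    apply Rmult_le_compat.
    - left; apply exp_pos.
    - left; apply Rinv_0_lt_compat, pow_lt; lra.
    - apply exp_le; nra.
    - apply Rinv_le_contravar; [apply pow_lt; lra|].
      apply Rle_pow; [lra|exact Hk]. }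
  pose proof (exp_pos t) as Hexp.
  assert (H1 : Rabs (RInt (fun y => Re (kernel t k (1, y))) (- r) r -
                     RInt (fun y => Re (kernel t k (- r, y))) (- r) r)
               <= 2 * (exp t / r ^ 2) * (1 - - r)).
  { apply (vertical_line_shift (- r - 1) 2); try lra.
    - apply holomorphic_strip_kernel; lra.
    - intros x Hx; split; apply Hb; simpl; try lra;
        (eapply Rle_trans; [|apply im_le_Cmod]); simpl;
        unfold Rabs; destruct Rcase_abs; lra. }
  assert (H2 : Rabs (RInt (fun y => Re (kernel t k (- r, y))) (- r) r)
               <= (r - - r) * (exp t / r ^ 2)).
  { apply abs_RInt_le_const; [lra| |].
    - apply (holomorphic_strip_ex_RInt (- r - 1) 2); [|lra].
      apply holomorphic_strip_kernel; lra.
    - intros y _. eapply Rle_trans; [apply re_le_Cmod|].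
      apply Hb; [simpl; lra|].
      eapply Rle_trans; [|apply re_le_Cmod]; simpl.
      unfold Rabs; destruct Rcase_abs; lra. }
  set (X := RInt (fun y => Re (kernel t k (1, y))) (- r) r) in *.
  set (Y := RInt (fun y => Re (kernel t k (- r, y))) (- r) r) in *.
  assert (H3 : exp t / r ^ 2 = exp t / r * / r) by (field; lra).
  assert (H4 : 0 < exp t / r) by (apply Rdiv_lt_0_compat; lra).
  assert (H5 : exp t / r ^ 2 * r = exp t / r) by (field; lra).
  assert (H6 : 0 <= exp t / r ^ 2) by (apply Rlt_le, Rdiv_lt_0_compat; [lra|apply pow_lt; lra]).
  replace (6 * exp t / r) with (6 * (exp t / r)) by (field; lra).
  replace X with ((X - Y) + Y) by ring.
  eapply Rle_trans; [apply Rabs_triang|].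
  nra.
Qed.

(** * Non-vanishing of the functional on 1 / (s + 1) *)

Lemma continuous_2d_snd (G : C -> C) x y :
  continuous_2d G x y ->
  continuity_pt (fun b => Re (G (x, b))) y /\ continuity_pt (fun b => Im (G (x, b))) y.
Proof.
  intros [H1 H2]; split; apply continuity_pt_filterlim.
  - apply (continuity_2d_snd (fun a b => Re (G (a, b)))), H1.
  - apply (continuity_2d_snd (fun a b => Im (G (a, b)))), H2.
Qed.

(** The functional L, truncated at height [r], at the test function 1 / (s + 1). *)
Definition kernel_pairing (t : R) (k : nat) (r : R) : R :=
  RInt (fun y => Re (/ ((1, y) + 1) * kernel t k (1, y))%C) (- r) r.

Lemma ex_RInt_kernel_pairing t k r :
  ex_RInt (fun y => Re (/ ((1, y) + 1) * kernel t k (1, y))%C) (- r) r.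
Proof.
  apply (holomorphic_strip_ex_RInt 0 2 (fun s => / (s + 1) * kernel t k s)%C); [|lra].
  apply holomorphic_strip_mult; [|apply holomorphic_strip_kernel; lra].
  apply holomorphic_strip_inv_shift; intros x y Hx; apply Re_nonzero; simpl; lra.
Qed.

Lemma ex_RInt_kernel t k r : ex_RInt (fun y => Re (kernel t k (1, y))) (- r) r.
Proof.
  apply (holomorphic_strip_ex_RInt 0 2); [|lra]; apply holomorphic_strip_kernel; lra.
Qed.

(* Multiplying by [exp t] turns [exp (t s)] into [exp (t (s + 1))], whose [t]-derivative cancels
   the factor [/ (s + 1)] and leaves the integral of [kernel_integral_le]. *)
Lemma kernel_pairing_increment t k r :
  0 <= t -> (2 <= k)%nat -> 1 <= r ->
  Rabs (exp t * kernel_pairing t k r - kernel_pairing 0 k r)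
    <= 6 * exp t * exp t / r * t.
Proof.
  intros Ht Hk Hr.
  set (q := fun y : R => ((/ ((1, y) + RtoC (-3))) ^ k)%C).
  set (p := fun y : R => (/ ((1, y) + 1) * q y)%C).
  set (u := fun (tau y : R) => exp tau * Re (/ ((1, y) + 1) * kernel tau k (1, y))%C).
  set (w := fun (tau y : R) => exp tau * Re (kernel tau k (1, y))).
  assert (Hu : forall tau, RInt (u tau) (- r) r = exp tau * kernel_pairing tau k r).
  { intros tau; apply (is_RInt_unique (V := R_CompleteNormedModule)).
    apply (is_RInt_scal (V := R_NormedModule)), (RInt_correct (V := R_CompleteNormedModule)),
      ex_RInt_kernel_pairing. }
  assert (Hw : forall tau, RInt (w tau) (- r) r =
                 exp tau * RInt (fun y => Re (kernel tau k (1, y))) (- r) r).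
  { intros tau; apply (is_RInt_unique (V := R_CompleteNormedModule)).
    apply (is_RInt_scal (V := R_NormedModule)), (RInt_correct (V := R_CompleteNormedModule)),
      ex_RInt_kernel. }
  rewrite <- Hu.
  replace (kernel_pairing 0 k r) with (RInt (u 0) (- r) r) by (rewrite Hu, exp_0; apply Rmult_1_l).
  replace (6 * exp t * exp t / r * t) with (exp t * (6 * exp t / r) * (t - 0)) by (field; lra).
  apply (RInt_param_increment u w (-1) (t + 1)); try lra.
  - intros tau y _.
    assert (Hq1 : q y = ((2, y) * p y)%C).
    { unfold p. replace (2, y) with ((1, y) + 1)%C
        by (apply injective_projections; simpl; ring).
      field. apply Re_nonzero; simpl; lra. }
    unfold w, u, kernel. fold (q y).
    apply (is_derive_ext (fun tau => exp tau * Re (exp_scaled tau (1, y) * p y)%C)).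
    { intros z; apply f_equal, f_equal. unfold p, q; ring. }
    rewrite Hq1. destruct (p y) as [p1 p2]. unfold exp_scaled; simpl.
    auto_derive; trivial. ring.
  - intros tau y _.
    destruct (continuous_2d_snd (fun s => (/ (s + RtoC (-3))) ^ k)%C 1 y) as [C1 C2].
    { destruct (holomorphic_strip_pow 0 2 (fun s => / (s + RtoC (-3)))%C k) as [G' HG].
      - apply holomorphic_strip_inv_shift; intros a b Ha; apply Re_nonzero; simpl; lra.
      - apply HG; lra. }
    assert (D1 : continuity_2d_pt (fun _ b => Re (q b)) tau y).
    { apply (continuity_1d_2d_pt_comp (fun b => Re (q b))); [exact C1|apply continuity_2d_pt_id2]. }
    assert (D2 : continuity_2d_pt (fun _ b => Im (q b)) tau y).
    { apply (continuity_1d_2d_pt_comp (fun b => Im (q b))); [exact C2|apply continuity_2d_pt_id2]. }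
    assert (D3 : continuity_2d_pt (fun a b => a * b) tau y).
    { apply continuity_2d_pt_mult; [apply continuity_2d_pt_id1|apply continuity_2d_pt_id2]. }
    assert (D4 : continuity_2d_pt (fun a b => exp (a * 1)) tau y).
    { apply (continuity_1d_2d_pt_comp exp); [apply derivable_continuous_pt, derivable_pt_exp|].
      apply continuity_2d_pt_mult; [apply continuity_2d_pt_id1|apply continuity_2d_pt_const]. }
    apply continuity_2d_pt_mult.
    { apply (continuity_1d_2d_pt_comp exp); [apply derivable_continuous_pt, derivable_pt_exp|].
      apply continuity_2d_pt_id1. }
    unfold kernel, exp_scaled; simpl.
    apply continuity_2d_pt_minus; apply continuity_2d_pt_mult; try assumption;
      apply continuity_2d_pt_mult; try exact D4.
    + apply (continuity_1d_2d_pt_comp cos); [apply continuity_cos|exact D3].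
    + apply (continuity_1d_2d_pt_comp sin); [apply continuity_sin|exact D3].
  - intros tau _; apply (ex_RInt_scal (V := R_NormedModule)), ex_RInt_kernel_pairing.
  - intros tau Htau. rewrite Hw, Rabs_mult, (Rabs_right (exp tau)) by (left; apply exp_pos).
    apply Rmult_le_compat; [left; apply exp_pos|apply Rabs_pos|apply exp_le; lra|].
    eapply Rle_trans; [apply kernel_integral_le; lra || exact Hk|].
    apply Rmult_le_compat_r; [left; apply Rinv_0_lt_compat; lra|].
    apply Rmult_le_compat_l; [lra|apply exp_le; lra].
Qed.

Lemma kernel_0 k s : kernel 0 k s = ((/ (s + RtoC (-3))) ^ k)%C.
Proof.
  unfold kernel, exp_scaled; rewrite !Rmult_0_l, exp_0, cos_0, sin_0.
  replace (1 * 1, 1 * 0) with (RtoC 1) by (apply injective_projections; simpl; ring).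
  ring.
Qed.

(** For k = 1 the integrand is exactly -1 / (4 + y^2). The recursion on k has to start here, since
    [kernel_integral_le] needs an exponent of at least 2. *)
Lemma kernel_pairing_0_1 r : kernel_pairing 0 1 r = - atan (r / 2).
Proof.
  unfold kernel_pairing.
  assert (E : forall y, - / (4 + y ^ 2) = Re (/ ((1, y) + 1) * kernel 0 1 (1, y))%C).
  { intros y. rewrite kernel_0. simpl. field. nra. }
  apply (is_RInt_unique (V := R_CompleteNormedModule)).
  apply (is_RInt_ext (fun y => - / (4 + y ^ 2))); [intros y _; apply E|].
  apply (is_RInt_opp (V := R_NormedModule)), is_RInt_inv_4_sqr.
Qed.

(** Partial fractions: the two denominators s + 1 and s - 3 differ by 4, so 1 / ((s + 1) (s - 3)) =
    (1 / (s - 3) - 1 / (s + 1)) / 4. *)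
Lemma kernel_pairing_0_S k r :
  kernel_pairing 0 (S k) r =
  / 4 * (RInt (fun y => Re (kernel 0 (S k) (1, y))) (- r) r - kernel_pairing 0 k r).
Proof.
  unfold kernel_pairing; apply (is_RInt_unique (V := R_CompleteNormedModule)).
  apply (is_RInt_ext (fun y => / 4 * (Re (kernel 0 (S k) (1, y)) -
           Re (/ ((1, y) + 1) * kernel 0 k (1, y))%C))).
  { intros y _. rewrite !kernel_0.
    replace (/ ((1, y) + 1) * (/ ((1, y) + RtoC (-3))) ^ S k)%C with
      (RtoC (/ 4) * ((/ ((1, y) + RtoC (-3))) ^ S k -
         / ((1, y) + 1) * (/ ((1, y) + RtoC (-3))) ^ k))%C.
    - generalize ((/ ((1, y) + RtoC (-3))) ^ S k)%C
        (/ ((1, y) + 1) * (/ ((1, y) + RtoC (-3))) ^ k)%C.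
      intros [a1 a2] [b1 b2]; simpl; ring.
    - simpl Cpow. generalize ((/ ((1, y) + RtoC (-3))) ^ k)%C; intros X.
      assert (Ha : ((1, y) + 1)%C <> RtoC 0) by (apply Re_nonzero; simpl; lra).
      assert (Hb : ((1, y) + RtoC (-3))%C <> RtoC 0) by (apply Re_nonzero; simpl; lra).
      assert (E : (RtoC (/ 4) * (((1, y) + 1) - ((1, y) + RtoC (-3))))%C = RtoC 1)
        by (apply injective_projections; simpl; lra).
      set (a := ((1, y) + 1)%C) in *. set (b := ((1, y) + RtoC (-3))%C) in *.
      transitivity (RtoC (/ 4) * (a - b) * (/ a * / b * X))%C; [field; tauto|].
      rewrite E; ring. }
  apply (is_RInt_scal (V := R_NormedModule)), (is_RInt_minus (V := R_NormedModule));
    apply (RInt_correct (V := R_CompleteNormedModule)).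
  - apply ex_RInt_kernel.
  - apply ex_RInt_kernel_pairing.
Qed.

Lemma kernel_pairing_0_lower_bound k :
  exists c r0, 0 < c /\ forall r, r0 <= r -> c <= Rabs (kernel_pairing 0 (S k) r).
Proof.
  induction k as [|k [c [r0 [Hc H]]]].
  - exists (atan (/ 2)), 1; split.
    + rewrite <- atan_0; apply atan_increasing; lra.
    + intros r Hr. rewrite kernel_pairing_0_1, Rabs_Ropp.
      eapply Rle_trans; [|apply Rle_abs].
      destruct (Req_dec r 1) as [->|Hn]; [right; f_equal; lra|].
      left; apply atan_increasing; lra.
  (* From r >= 12 / c on, the kernel integral, bounded by 6 / r, is at most c / 2; what remains is
     (c - c / 2) / 4 = c / 8. *)
  - exists (c / 8), (Rmax (Rmax 1 r0) (12 / c)); split; [lra|].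
    intros r Hr.
    assert (R1 : 1 <= r) by (eapply Rle_trans; [|exact Hr]; eapply Rle_trans; [|apply Rmax_l]; apply Rmax_l).
    assert (R2 : r0 <= r) by (eapply Rle_trans; [|exact Hr]; eapply Rle_trans; [|apply Rmax_l]; apply Rmax_r).
    assert (R3 : 12 / c <= r) by (eapply Rle_trans; [|exact Hr]; apply Rmax_r).
    specialize (H r R2). rewrite kernel_pairing_0_S.
    pose proof (kernel_integral_le 0 (S (S k)) r (Rle_refl 0) ltac:(lia) R1) as HA.
    rewrite exp_0 in HA.
    set (X := RInt _ _ _) in *. set (Y := kernel_pairing _ _ _) in *.
    assert (6 * 1 / r <= c / 2).
    { apply (Rmult_le_reg_r r); [lra|]. replace (6 * 1 / r * r) with 6 by (field; lra).
      apply (Rmult_le_compat_r c) in R3; [|lra].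
      replace (12 / c * c) with 12 in R3 by (field; lra). lra. }
    rewrite Rabs_mult, Rabs_right by lra.
    pose proof (Rabs_triang_inv Y X). rewrite Rabs_minus_sym in H1. lra.
Qed.

Lemma kernel_pairing_lower_bound t k :
  0 <= t -> (2 <= k)%nat ->
  exists c r0, 0 < c /\ forall r, r0 <= r -> c <= Rabs (kernel_pairing t k r).
Proof.
  intros Ht Hk. destruct k as [|k]; [lia|].
  destruct (kernel_pairing_0_lower_bound k) as [c [r0 [Hc H]]].
  pose proof (exp_pos t) as He.
  set (D := 6 * exp t * exp t * t).
  assert (HD : 0 <= D) by (unfold D; apply Rmult_le_pos; [nra|lra]).
  (* The error in [kernel_pairing_increment] is D / r, at most c / 2 beyond this threshold; the
     factor exp t is then divided out. *)
  exists (c / 2 / exp t), (Rmax (Rmax 1 r0) (2 * D / c)); split.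
  { apply Rdiv_lt_0_compat; lra. }
  intros r Hr.
  assert (R1 : 1 <= r) by (eapply Rle_trans; [|exact Hr]; eapply Rle_trans; [|apply Rmax_l]; apply Rmax_l).
  assert (R2 : r0 <= r) by (eapply Rle_trans; [|exact Hr]; eapply Rle_trans; [|apply Rmax_l]; apply Rmax_r).
  assert (R3 : 2 * D / c <= r) by (eapply Rle_trans; [|exact Hr]; apply Rmax_r).
  specialize (H r R2).
  pose proof (kernel_pairing_increment t (S k) r Ht Hk R1) as HI.
  set (Y := kernel_pairing 0 (S k) r) in *. set (X := kernel_pairing t (S k) r) in *.
  assert (HDr : 6 * exp t * exp t / r * t <= c / 2).
  { replace (6 * exp t * exp t / r * t) with (D / r) by (unfold D; field; lra).
    apply (Rmult_le_reg_r r); [lra|]. replace (D / r * r) with D by (field; lra).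
    apply (Rmult_le_compat_r c) in R3; [|lra].
    replace (2 * D / c * c) with (2 * D) in R3 by (field; lra). lra. }
  pose proof (Rabs_triang_inv Y (exp t * X)) as HT. rewrite Rabs_minus_sym in HT.
  rewrite Rabs_mult, (Rabs_right (exp t)) in HT by lra.
  apply (Rmult_le_reg_r (exp t)); [lra|].
  replace (c / 2 / exp t * exp t) with (c / 2) by (field; lra). lra.
Qed.

(** * Weighted Dirichlet spaces *)

Lemma pow_n_Cpow (z : C) n : pow_n (K := C_AbsRing) z n = (z ^ n)%C.
Proof. induction n as [|n IH]; [reflexivity|simpl; now rewrite IH]. Qed.

Lemma is_series_eventually_zero {K : AbsRing} {V : NormedModule K} (a : nat -> V) n :
  (forall k, (n < k)%nat -> a k = zero) -> is_series a (sum_n a n).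
Proof.
  intros H; apply (filterlim_ext_loc (fun _ => sum_n a n)); [|apply filterlim_const].
  exists n; intros m Hm; induction Hm as [|m Hm IH]; [reflexivity|].
  rewrite sum_Sn, <- IH, H by lia; symmetry; apply plus_zero_r.
Qed.

Lemma term_le_Series (a : nat -> R) n :
  (forall k, 0 <= a k) -> ex_series a -> a n <= Series a.
Proof.
  intros Ha Hs.
  assert (H : sum_n a n <= Series a).
  { apply (is_lim_seq_incr_compare (sum_n a)).
    - apply (Series_correct a Hs).
    - intros k; rewrite sum_Sn; unfold plus; simpl; specialize (Ha (S k)); lra. }
  destruct n as [|n]; [now rewrite sum_O in H|].
  rewrite sum_Sn in H; unfold plus in H; simpl in H.
  assert (0 <= sum_n a n); [|lra].
  clear -Ha; induction n as [|n IH]; [rewrite sum_O; apply Ha|].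
  rewrite sum_Sn; unfold plus; simpl; specialize (Ha (S n)); lra.
Qed.

(** On the real diameter a complex power series splits into two real ones, which reduces uniqueness
    of complex coefficients to the real case. *)
Lemma taylor_series_real (f : C -> C) (a : nat -> C) (x : R) :
  Rabs x < 1 -> taylor_series f a ->
  is_pseries (fun k => Re (a k)) x (Re (f x)) /\ is_pseries (fun k => Im (a k)) x (Im (f x)).
Proof.
  intros Hx H.
  assert (Hd : disk x) by (unfold disk; now rewrite Cmod_R).
  specialize (H x Hd); unfold is_pseries, is_series in H.
  assert (E : forall n, sum_n (fun k => scal (pow_n (K := C_AbsRing) (RtoC x) k) (a k)) n =
            (sum_n (fun k => scal (pow_n (K := R_AbsRing) x k) (Re (a k))) n,
             sum_n (fun k => scal (pow_n (K := R_AbsRing) x k) (Im (a k))) n)).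
  { assert (T : forall k, scal (pow_n (K := C_AbsRing) (RtoC x) k) (a k) =
              (scal (pow_n (K := R_AbsRing) x k) (Re (a k)),
               scal (pow_n (K := R_AbsRing) x k) (Im (a k))) :> C).
    { intros k; rewrite pow_n_Cpow, pow_n_pow, <- RtoC_pow.
      unfold scal; simpl; unfold mult; simpl; unfold Cmult, RtoC; simpl.
      apply injective_projections; unfold Re, Im; simpl; ring. }
    intros n; induction n as [|n IH]; [rewrite !sum_O; apply T|].
    rewrite !sum_Sn, IH, T; reflexivity. }
  split; unfold is_pseries, is_series.
  - apply (filterlim_ext (fun n => fst (sum_n (fun k => scal (pow_n (K := C_AbsRing) (RtoC x) k) (a k)) n))).
    { intros n; now rewrite E. }
    apply (filterlim_comp _ _ _ _ fst _ _ _ H).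
    intros P [e HP]; exists e; intros y Hy. apply HP.
    apply Hy.
  - apply (filterlim_ext (fun n => snd (sum_n (fun k => scal (pow_n (K := C_AbsRing) (RtoC x) k) (a k)) n))).
    { intros n; now rewrite E. }
    apply (filterlim_comp _ _ _ _ snd _ _ _ H).
    intros P [e HP]; exists e; intros y Hy. apply HP.
    apply Hy.
Qed.

Lemma pseries_coef_unique (a b : nat -> R) (f : R -> R) :
  (forall x, Rabs x < 1 -> is_pseries a x (f x)) ->
  (forall x, Rabs x < 1 -> is_pseries b x (f x)) ->
  forall n, a n = b n.
Proof.
  assert (Hr : forall c : nat -> R, (forall x, Rabs x < 1 -> is_pseries c x (f x)) ->
            Rbar_lt 0 (CV_radius c)).
  { intros c Hc.
    destruct (Rbar_lt_dec 0 (CV_radius c)) as [H|H]; [exact H|exfalso].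
    (* The series converges at 1/2, which is impossible if the radius of convergence is not
       positive. *)
    apply (CV_disk_outside c (/ 2)).
    - apply (Rbar_le_lt_trans _ 0); [now apply Rbar_not_lt_le|].
      simpl; rewrite Rabs_right; lra.
    - apply ex_series_lim_0. exists (f (/ 2)).
      apply (is_series_ext (fun k => scal (pow_n (K := R_AbsRing) (/ 2) k) (c k))).
      + intros n; rewrite pow_n_pow; apply Rmult_comm.
      + apply Hc; rewrite Rabs_right; lra. }
  intros Ha Hb n.
  apply PSeries_ext_recip; [now apply Hr|now apply Hr|].
  exists (mkposreal 1 Rlt_0_1); intros x Hx.
  assert (Hx1 : Rabs x < 1).
  { replace x with (x - 0) by ring; exact Hx. }
  rewrite (is_pseries_unique _ _ _ (Ha x Hx1)).
  now rewrite (is_pseries_unique _ _ _ (Hb x Hx1)).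
Qed.

Lemma taylor_coef_spec f : analytic_on_disk f -> taylor_series f (taylor_coef f).
Proof. apply epsilon_spec. Qed.

(** This makes the choice by [epsilon] harmless: any expansion computed by hand is the chosen
    one. *)
Lemma taylor_coef_unique f a : taylor_series f a -> forall n, taylor_coef f n = a n.
Proof.
  intros Ha n.
  assert (Hc : taylor_series f (taylor_coef f)) by (apply taylor_coef_spec; now exists a).
  revert Hc; generalize (taylor_coef f); intros c Hc.
  apply injective_projections.
  - apply (pseries_coef_unique (fun k => Re (c k)) (fun k => Re (a k)) (fun x => Re (f x)));
      intros x Hx.
    + exact (proj1 (taylor_series_real f c x Hx Hc)).
    + exact (proj1 (taylor_series_real f a x Hx Ha)).
  - apply (pseries_coef_unique (fun k => Im (c k)) (fun k => Im (a k)) (fun x => Im (f x)));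
      intros x Hx.
    + exact (proj2 (taylor_series_real f c x Hx Hc)).
    + exact (proj2 (taylor_series_real f a x Hx Ha)).
Qed.

Lemma taylor_series_minus f g a b :
  taylor_series f a -> taylor_series g b ->
  taylor_series (fun z => f z - g z)%C (fun n => a n - b n)%C.
Proof.
  intros Ha Hb z Hz.
  apply (is_series_ext (fun n => plus (scal (pow_n (K := C_AbsRing) z n) (a n))
                                   (opp (scal (pow_n (K := C_AbsRing) z n) (b n))))).
  - intros n; rewrite pow_n_Cpow; unfold scal, plus, opp; simpl; unfold mult; simpl.
    match goal with |- ?l = ?r => change (@eq C l r) end; ring.
  - apply (is_series_minus (V := C_NormedModule)); [apply Ha, Hz|apply Hb, Hz].
Qed.

(** A substitute for the triangle inequality that passes to weighted sums of squares term by term,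
    with no need for Minkowski's inequality. *)
Lemma Cmod_minus_sqr_le (x y : C) :
  Cmod (x - y) ^ 2 <= 2 * Cmod x ^ 2 + 2 * Cmod y ^ 2.
Proof.
  rewrite !Cmod2_alt; destruct x as [x1 x2], y as [y1 y2]; simpl.
  pose proof (pow2_ge_0 (x1 + y1)); pose proof (pow2_ge_0 (x2 + y2)); lra.
Qed.

Lemma dirichlet_term_nonneg nu f n : 0 <= dirichlet_term nu f n.
Proof.
  unfold dirichlet_term; apply Rmult_le_pos; [apply pow2_ge_0|].
  left; apply exp_pos.
Qed.

Lemma dirichlet_term_minus_le nu f g n :
  analytic_on_disk f -> analytic_on_disk g ->
  dirichlet_term nu (fun z => f z - g z)%C n
    <= 2 * dirichlet_term nu f n + 2 * dirichlet_term nu g n.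
Proof.
  intros Hf Hg; unfold dirichlet_term.
  rewrite (taylor_coef_unique _ _
    (taylor_series_minus f g _ _ (taylor_coef_spec f Hf) (taylor_coef_spec g Hg))).
  pose proof (Cmod_minus_sqr_le (taylor_coef f n) (taylor_coef g n)) as H.
  apply (Rmult_le_compat_r (Rpower (INR n + 1) (2 * nu))) in H; [|left; apply exp_pos].
  lra.
Qed.

Lemma ex_series_dirichlet_term_sum nu f g :
  dirichlet_space nu f -> dirichlet_space nu g ->
  ex_series (fun n => 2 * dirichlet_term nu f n + 2 * dirichlet_term nu g n).
Proof.
  intros [_ Hf] [_ Hg].
  apply (ex_series_plus (fun n => 2 * dirichlet_term nu f n)
           (fun n => 2 * dirichlet_term nu g n)); now apply (ex_series_scal (V := R_NormedModule)).
Qed.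

Lemma dirichlet_space_minus nu f g :
  dirichlet_space nu f -> dirichlet_space nu g ->
  dirichlet_space nu (fun z => f z - g z)%C.
Proof.
  intros Hf Hg; split.
  - eexists; apply taylor_series_minus; apply taylor_coef_spec; [apply Hf|apply Hg].
  - apply (ex_series_le (V := R_CompleteNormedModule)) with
      (b := fun n => 2 * dirichlet_term nu f n + 2 * dirichlet_term nu g n).
    + intros n. change norm with Rabs. rewrite Rabs_right by apply Rle_ge, dirichlet_term_nonneg.
      apply dirichlet_term_minus_le; [apply Hf|apply Hg].
    + now apply ex_series_dirichlet_term_sum.
Qed.

Lemma dirichlet_norm_nonneg nu f : 0 <= dirichlet_norm nu f.
Proof. apply sqrt_pos. Qed.

Lemma dirichlet_norm_sqr nu f :
  dirichlet_space nu f -> dirichlet_norm nu f ^ 2 = Series (dirichlet_term nu f).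
Proof.
  intros [_ H]; unfold dirichlet_norm; rewrite pow2_sqrt; [reflexivity|].
  eapply Rle_trans; [apply (dirichlet_term_nonneg nu f 0)|].
  apply term_le_Series; [apply dirichlet_term_nonneg|exact H].
Qed.

Lemma dirichlet_norm_minus_sqr_le nu f g :
  dirichlet_space nu f -> dirichlet_space nu g ->
  dirichlet_norm nu (fun z => f z - g z)%C ^ 2
    <= 2 * dirichlet_norm nu f ^ 2 + 2 * dirichlet_norm nu g ^ 2.
Proof.
  intros Hf Hg.
  pose proof (dirichlet_space_minus nu f g Hf Hg) as Hfg.
  rewrite !dirichlet_norm_sqr by assumption.
  rewrite <- !Series_scal_l, <- Series_plus
    by (apply (ex_series_scal (V := R_NormedModule)); first [apply Hf|apply Hg]).
  apply Series_le; [|now apply ex_series_dirichlet_term_sum].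
  intros n; split; [apply dirichlet_term_nonneg|].
  apply dirichlet_term_minus_le; [apply Hf|apply Hg].
Qed.

(** * Balls and open sets of the Dirichlet space *)

Lemma dirichlet_norm_ext nu f g :
  (forall z, f z = g z) -> dirichlet_norm nu f = dirichlet_norm nu g.
Proof. intros H; f_equal; now apply functional_extensionality. Qed.

Definition dirichlet_ball (nu : R) (f0 : C -> C) (eps : R) (g : C -> C) : Prop :=
  dirichlet_space nu g /\ dirichlet_norm nu (fun z => g z - f0 z)%C < eps.

(* Openness of a ball would need the triangle inequality for [dirichlet_norm]; for its interior
   [dirichlet_norm_minus_sqr_le] is enough. *)
Definition dirichlet_ball_interior (nu : R) (f0 : C -> C) (eps : R) (g : C -> C) : Prop :=
  dirichlet_space nu g /\ exists d, 0 < d /\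
    forall h, dirichlet_ball nu g d h -> dirichlet_ball nu f0 eps h.

Lemma dirichlet_norm_self nu f : dirichlet_norm nu (fun z => f z - f z)%C = 0.
Proof.
  assert (H : taylor_series (fun z => f z - f z)%C (fun _ => RtoC 0)).
  { intros z _.
    replace (f z - f z)%C with (RtoC 0) by (apply injective_projections; simpl; ring).
    apply (is_series_ext (fun _ => zero : C_NormedModule)).
    - intros n; symmetry; apply (scal_zero_r (V := C_NormedModule)).
    - replace (RtoC 0) with (sum_n (fun _ => zero : C_NormedModule) 0) by apply sum_O.
      apply is_series_eventually_zero; reflexivity. }
  unfold dirichlet_norm. rewrite (Series_ext _ (fun _ => 0)).
  - rewrite (is_series_unique _ _ (is_series_eventually_zero (fun _ => 0) 0 (fun _ _ => eq_refl))).
    rewrite sum_O; apply sqrt_0.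
  - intros n; unfold dirichlet_term. rewrite (taylor_coef_unique _ _ H), Cmod_0. ring.
Qed.

Lemma dirichlet_ball_interior_subset nu f0 eps g :
  dirichlet_ball_interior nu f0 eps g -> dirichlet_ball nu f0 eps g.
Proof.
  intros [Hg [d [Hd H]]]; apply H; split; [exact Hg|].
  now rewrite dirichlet_norm_self.
Qed.

Lemma dirichlet_ball_interior_center nu f0 eps :
  0 < eps -> dirichlet_space nu f0 -> dirichlet_ball_interior nu f0 eps f0.
Proof. intros He Hf; split; [exact Hf|exists eps; tauto]. Qed.

Lemma dirichlet_ball_interior_open nu f0 eps :
  dirichlet_open nu (dirichlet_ball_interior nu f0 eps).
Proof.
  split; [intros f [Hf _]; exact Hf|].
  (* With radii d / 4, the two estimates below give a squared norm of at most 6 (d / 4)^2 < d^2. *)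
  intros f [Hf [d [Hd H]]]. exists (d / 4); split; [lra|].
  intros g Hg Hgf; split; [exact Hg|].
  exists (d / 4); split; [lra|].
  intros h [Hh Hhg]; apply H; split; [exact Hh|].
  pose proof (dirichlet_norm_minus_sqr_le nu (fun z => h z - g z)%C (fun z => f z - g z)%C
    (dirichlet_space_minus _ _ _ Hh Hg) (dirichlet_space_minus _ _ _ Hf Hg)) as Q.
  rewrite (dirichlet_norm_ext _ _ (fun z => h z - f z)%C) in Q by (intros z; ring).
  (* Replaces symmetry of the distance: f - g is written as (f - f) - (g - f). *)
  pose proof (dirichlet_norm_minus_sqr_le nu (fun z => f z - f z)%C (fun z => g z - f z)%C
    (dirichlet_space_minus _ _ _ Hf Hf) (dirichlet_space_minus _ _ _ Hg Hf)) as Q2.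
  rewrite (dirichlet_norm_ext _ _ (fun z => f z - g z)%C) in Q2 by (intros z; ring).
  rewrite dirichlet_norm_self in Q2.
  pose proof (dirichlet_norm_nonneg nu (fun z => h z - g z)%C).
  pose proof (dirichlet_norm_nonneg nu (fun z => g z - f z)%C).
  pose proof (dirichlet_norm_nonneg nu (fun z => h z - f z)%C).
  nra.
Qed.

(** A single term of the series bounds the coefficient by the norm times (n + 1)^(-nu). Rounding -nu
    up to a natural number [p] keeps all later growth estimates in natural powers. *)
Lemma taylor_coef_le nu p f n :
  dirichlet_space nu f -> - nu <= INR p ->
  Cmod (taylor_coef f n) <= dirichlet_norm nu f * (INR n + 1) ^ p.
Proof.
  intros Hf Hp.
  assert (H1 : 1 <= INR n + 1) by (pose proof (pos_INR n); lra).
  pose proof (term_le_Series (dirichlet_term nu f) n (dirichlet_term_nonneg nu f) (proj2 Hf)) as H.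
  rewrite <- dirichlet_norm_sqr in H by exact Hf.
  unfold dirichlet_term in H.
  replace (2 * nu) with (nu + nu) in H by ring; rewrite Rpower_plus in H.
  set (w := Rpower (INR n + 1) nu) in *.
  assert (Hw : 0 < w) by apply exp_pos.
  pose proof (dirichlet_norm_nonneg nu f) as HN.
  pose proof (Cmod_ge_0 (taylor_coef f n)) as HC.
  assert (H2 : Cmod (taylor_coef f n) * w <= dirichlet_norm nu f).
  { apply Rsqr_incr_0_var; [unfold Rsqr; nra|exact HN]. }
  assert (H3 : / w <= (INR n + 1) ^ p).
  { unfold w; rewrite <- Rpower_Ropp, <- Rpower_pow by lra. now apply Rle_Rpower. }
  replace (Cmod (taylor_coef f n)) with (Cmod (taylor_coef f n) * w * / w) by (field; lra).
  apply Rmult_le_compat; try assumption.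
  - nra.
  - left; now apply Rinv_0_lt_compat.
Qed.

Lemma geometric_sum_le rho n : 0 <= rho < 1 -> sum_n (fun k => rho ^ k) n <= / (1 - rho).
Proof.
  intros Hr.
  assert (E : sum_n (fun k => rho ^ k) n * (1 - rho) = 1 - rho ^ S n).
  { induction n as [|n IH]; [rewrite sum_O; simpl; ring|].
    rewrite sum_Sn; unfold plus; simpl; simpl in IH; lra. }
  apply (Rmult_le_reg_r (1 - rho)); [lra|]. rewrite E, Rinv_l by lra.
  pose proof (pow_le rho (S n) (proj1 Hr)); lra.
Qed.

(** Each of the n + 1 terms of 1 + rho + ... + rho^n is at least rho^n. *)
Lemma succ_mul_pow_le rho n : 0 <= rho < 1 -> (INR n + 1) * rho ^ n <= / (1 - rho).
Proof.
  intros Hr.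
  apply (Rmult_le_reg_r (1 - rho)); [lra|]. rewrite Rinv_l by lra.
  assert (H : (INR n + 1) * rho ^ n * (1 - rho) <= 1 - rho ^ S n).
  { induction n as [|n IH]; [simpl; lra|].
    assert (Hq : 0 <= rho ^ S n <= 1).
    { split; [apply pow_le; lra|]. rewrite <- (pow1 (S n)); apply pow_incr; lra. }
    rewrite S_INR. change (rho ^ S (S n)) with (rho * rho ^ S n).
    change (rho ^ S n) with (rho * rho ^ n) in *.
    set (q := rho ^ n) in *. set (N := INR n) in *.
    nra. }
  pose proof (pow_le rho (S n) (proj1 Hr)); lra.
Qed.

Lemma bernoulli_le h n : 0 <= h <= 1 -> 1 - INR n * h <= (1 - h) ^ n.
Proof.
  intros Hh; induction n as [|n IH]; [simpl; lra|].
  rewrite S_INR; simpl. pose proof (pos_INR n). nra.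
Qed.

(** With 1 - rho = (1 - x) / (p + 1), Bernoulli gives x <= rho^(p + 1). Each of the p factors k + 1
    then absorbs one rho^k by [succ_mul_pow_le], and the last rho^k is summed as a geometric
    series. *)
Lemma sum_succ_pow_mul_pow_le p x n :
  0 <= x < 1 ->
  sum_n (fun k => (INR k + 1) ^ p * x ^ k) n <= (INR (S p) / (1 - x)) ^ S p.
Proof.
  intros Hx. set (rho := 1 - (1 - x) / INR (S p)).
  assert (HP : 1 <= INR (S p)) by (rewrite S_INR; pose proof (pos_INR p); lra).
  assert (Hh : 0 < (1 - x) / INR (S p) <= 1).
  { split; [apply Rdiv_lt_0_compat; lra|].
    apply (Rmult_le_reg_r (INR (S p))); [lra|].
    replace ((1 - x) / INR (S p) * INR (S p)) with (1 - x) by (field; lra). lra. }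
  assert (Hrho : 0 <= rho < 1) by (unfold rho; lra).
  assert (Hx' : x <= rho ^ S p).
  { unfold rho; eapply Rle_trans; [|apply bernoulli_le; lra].
    replace (INR (S p) * ((1 - x) / INR (S p))) with (1 - x) by (field; lra). lra. }
  replace (INR (S p) / (1 - x)) with (/ (1 - rho)).
  2: { unfold rho; field; lra. }
  assert (Hi : 0 < / (1 - rho)) by (apply Rinv_0_lt_compat; lra).
  apply Rle_trans with (sum_n (fun k => (/ (1 - rho)) ^ p * rho ^ k) n).
  - apply sum_n_m_le; intros k.
    apply Rle_trans with (((INR k + 1) * rho ^ k) ^ p * rho ^ k).
    + rewrite Rpow_mult_distr, Rmult_assoc.
      assert (0 <= INR k + 1) by (pose proof (pos_INR k); lra).
      apply Rmult_le_compat_l; [now apply pow_le|].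
      replace ((rho ^ k) ^ p * rho ^ k) with ((rho ^ S p) ^ k).
      * apply pow_incr; lra.
      * rewrite <- !pow_mult, <- pow_add. f_equal; lia.
    + apply Rmult_le_compat_r; [apply pow_le; lra|].
      apply pow_incr; split; [|now apply succ_mul_pow_le].
      apply Rmult_le_pos; [pose proof (pos_INR k); lra|apply pow_le; lra].
  - rewrite (sum_n_mult_l (K := R_AbsRing) ((/ (1 - rho)) ^ p)).
    simpl. unfold mult; simpl. rewrite (Rmult_comm (/ (1 - rho))).
    apply Rmult_le_compat_l; [apply pow_le; lra|now apply geometric_sum_le].
Qed.

Definition taylor_partial (f : C -> C) (n : nat) (z : C) : C :=
  sum_n (fun k => taylor_coef f k * z ^ k)%C n.

Lemma taylor_partial_cvg f z :
  analytic_on_disk f -> disk z ->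
  filterlim (fun n => taylor_partial f n z) eventually (locally (f z : C_NormedModule)).
Proof.
  intros Hf Hz.
  pose proof (taylor_coef_spec f Hf z Hz) as H.
  apply (filterlim_ext (sum_n (fun k => scal (pow_n (K := C_AbsRing) z k) (taylor_coef f k))));
    [|exact H].
  intros n; apply sum_n_ext; intros k; rewrite pow_n_Cpow; apply Cmult_comm.
Qed.

Lemma Cmod_limit_le (u : nat -> C) (l c : C) b :
  filterlim u eventually (locally (l : C_NormedModule)) ->
  eventually (fun n => Cmod (u n - c) <= b) -> Cmod (l - c) <= b.
Proof.
  intros Hu Hb.
  destruct (Rle_lt_dec (Cmod (l - c)) b) as [H|H]; [exact H|exfalso].
  assert (He : 0 < Cmod (l - c) - b) by lra.
  pose proof (Hu _ (locally_ball_norm (V := C_NormedModule) l (mkposreal _ He))) as Hu'.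
  destruct Hu' as [n1 H1]; destruct Hb as [n2 H2].
  specialize (H1 (n1 + n2)%nat ltac:(lia)); specialize (H2 (n1 + n2)%nat ltac:(lia)).
  set (v := u (n1 + n2)%nat) in *.
  assert (H3 : Cmod (v - l) < Cmod (l - c) - b) by exact H1.
  pose proof (Cmod_triangle (v - c) (- (v - l))) as HT.
  rewrite Cmod_opp in HT.
  replace (v - c + - (v - l))%C with (l - c)%C in HT by ring. lra.
Qed.

Lemma Cmod_sum_n_m_le (u : nat -> C) (v : nat -> R) n m :
  (forall k, Cmod (u k) <= v k) -> Cmod (sum_n_m u n m) <= sum_n_m v n m.
Proof.
  intros H. eapply Rle_trans; [apply (norm_sum_n_m (V := C_NormedModule))|].
  now apply sum_n_m_le.
Qed.

(** Summing moduli serves twice: it bounds the partial sums, hence the values of [f], and it gives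
    uniform convergence on smaller disks. *)
Lemma taylor_majorant_le nu p f x n :
  dirichlet_space nu f -> - nu <= INR p -> 0 <= x < 1 ->
  sum_n (fun k => Cmod (taylor_coef f k) * x ^ k) n
    <= dirichlet_norm nu f * (INR (S p) / (1 - x)) ^ S p.
Proof.
  intros Hf Hp Hx.
  apply Rle_trans with (sum_n (fun k => dirichlet_norm nu f * ((INR k + 1) ^ p * x ^ k)) n).
  - apply sum_n_m_le; intros k. rewrite <- Rmult_assoc.
    apply Rmult_le_compat_r; [apply pow_le; lra|now apply (taylor_coef_le nu)].
  - rewrite (sum_n_mult_l (K := R_AbsRing) (dirichlet_norm nu f)).
    apply Rmult_le_compat_l; [apply dirichlet_norm_nonneg|].
    now apply sum_succ_pow_mul_pow_le.
Qed.

Lemma taylor_partial_le nu p f z n :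
  dirichlet_space nu f -> - nu <= INR p -> disk z ->
  Cmod (taylor_partial f n z)
    <= dirichlet_norm nu f * (INR (S p) / (1 - Cmod z)) ^ S p.
Proof.
  intros Hf Hp Hz.
  eapply Rle_trans; [|apply (taylor_majorant_le nu p f (Cmod z) n Hf Hp)].
  - apply Cmod_sum_n_m_le; intros k; rewrite Cmod_mult, Cmod_pow; apply Rle_refl.
  - split; [apply Cmod_ge_0|exact Hz].
Qed.

Lemma evaluation_le nu p f z :
  dirichlet_space nu f -> - nu <= INR p -> disk z ->
  Cmod (f z) <= dirichlet_norm nu f * (INR (S p) / (1 - Cmod z)) ^ S p.
Proof.
  intros Hf Hp Hz.
  replace (f z) with (f z - 0)%C by ring.
  apply (Cmod_limit_le (fun n => taylor_partial f n z)); [apply taylor_partial_cvg; [apply Hf|exact Hz]|].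
  exists O; intros n _.
  replace (taylor_partial f n z - 0)%C with (taylor_partial f n z) by ring.
  now apply taylor_partial_le.
Qed.

(** Contours are shifted only for Taylor polynomials, whose holomorphy is algebraic; [f] itself
    enters through this approximation on a compact set. *)
Lemma taylor_partial_uniform nu p f r eta :
  dirichlet_space nu f -> - nu <= INR p -> 0 <= r < 1 -> 0 < eta ->
  exists n, forall z, Cmod z <= r -> Cmod (f z - taylor_partial f n z) <= eta.
Proof.
  intros Hf Hp Hr Heta.
  assert (Hs : ex_series (fun k => Cmod (taylor_coef f k) * r ^ k)).
  { assert (H : ex_finite_lim_seq (sum_n (fun k => Cmod (taylor_coef f k) * r ^ k))).
    { apply ex_finite_lim_seq_incr with (dirichlet_norm nu f * (INR (S p) / (1 - r)) ^ S p).
      - intros n; rewrite sum_Sn; unfold plus; simpl.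
        pose proof (pow_le r (S n) (proj1 Hr)); pose proof (Cmod_ge_0 (taylor_coef f (S n))).
        simpl in *; nra.
      - intros n; now apply taylor_majorant_le. }
    destruct H as [l Hl]; exists l; exact Hl. }
  destruct (Cauchy_ex_series _ Hs (mkposreal eta Heta)) as [n Hn].
  exists n; intros z Hz.
  assert (Hd : disk z) by (unfold disk; lra).
  apply (Cmod_limit_le (fun m => taylor_partial f m z)).
  { apply taylor_partial_cvg; [apply Hf|exact Hd]. }
  exists (S n); intros m Hm.
  assert (E : (taylor_partial f m z - taylor_partial f n z)%C =
              sum_n_m (fun k => taylor_coef f k * z ^ k)%C (S n) m).
  { symmetry; apply (sum_n_m_sum_n (fun k => taylor_coef f k * z ^ k)%C n m); lia. }
  rewrite E.
  eapply Rle_trans; [apply (Cmod_sum_n_m_le _ (fun k => Cmod (taylor_coef f k) * r ^ k))|].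
  - intros k; rewrite Cmod_mult, Cmod_pow.
    apply Rmult_le_compat_l; [apply Cmod_ge_0|].
    apply pow_incr; split; [apply Cmod_ge_0|exact Hz].
  - specialize (Hn (S n) m ltac:(lia) ltac:(lia)). simpl in Hn.
    left; eapply Rle_lt_trans; [|exact Hn]. apply Rle_abs.
Qed.

(** * Half-plane coordinates and the contour shift *)

(* The half-plane [Re s > 0] onto the disk, sending infinity to [zeta]: [zeta (s - 1) / (s + 1)]. *)
Definition cayley (zeta s : C) : C := (zeta * (1 + RtoC (-2) * / (s + 1)))%C.

(** The image has modulus m = |s - 1| / |s + 1|, and |s - 1|^2 = |s + 1|^2 - 4 Re s. Hence m^2 = 1 -
    2 u with u = 2 Re s / |s + 1|^2, and so m <= 1 - u. *)
Lemma cayley_boundary_distance zeta s :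
  Cmod zeta = 1 -> 0 < Re s ->
  2 * Re s / Cmod (s + 1) ^ 2 <= 1 - Cmod (cayley zeta s).
Proof.
  intros Hz Hs.
  assert (Hne : (s + 1)%C <> RtoC 0) by (apply Re_nonzero; simpl; unfold Re in Hs; lra).
  assert (HD : 0 < Cmod (s + 1) ^ 2) by (apply pow_lt, Cmod_gt_0, Hne).
  assert (E : Cmod (cayley zeta s) * Cmod (s + 1) = Cmod (s - 1)).
  { unfold cayley; rewrite Cmod_mult, Hz, Rmult_1_l, <- Cmod_mult.
    f_equal. replace (RtoC (-2)) with (- (1 + 1))%C by (apply injective_projections; simpl; ring).
    field; exact Hne. }
  assert (E2 : Cmod (s - 1) ^ 2 = Cmod (s + 1) ^ 2 - 4 * Re s).
  { rewrite !Cmod2_alt; destruct s as [x y]; simpl; ring. }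
  rewrite <- E, Rpow_mult_distr in E2.
  pose proof (Cmod_ge_0 (cayley zeta s)) as Hm.
  set (m := Cmod (cayley zeta s)) in *. set (D := Cmod (s + 1) ^ 2) in *.
  assert (E3 : m ^ 2 = 1 - 2 * (2 * Re s / D)).
  { apply (Rmult_eq_reg_r D); [rewrite E2; field; lra|lra]. }
  assert (0 < 2 * Re s / D) by (apply Rdiv_lt_0_compat; lra).
  nra.
Qed.

Lemma cayley_disk zeta s : Cmod zeta = 1 -> 0 < Re s -> disk (cayley zeta s).
Proof.
  intros Hz Hs; pose proof (cayley_boundary_distance zeta s Hz Hs) as H.
  assert (Hne : (s + 1)%C <> RtoC 0) by (apply Re_nonzero; simpl; unfold Re in Hs; lra).
  assert (0 < 2 * Re s / Cmod (s + 1) ^ 2).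
  { apply Rdiv_lt_0_compat; [lra|apply pow_lt, Cmod_gt_0, Hne]. }
  unfold disk; lra.
Qed.

(** Here growth near the unit circle becomes polynomial growth in s, of degree 2 (p + 1), which the
    power in the kernel has to beat. *)
Lemma growth_weight_cayley_le p zeta s :
  Cmod zeta = 1 -> 1 <= Re s ->
  (INR (S p) / (1 - Cmod (cayley zeta s))) ^ S p
    <= (INR (S p) * Cmod (s + 1) ^ 2) ^ S p.
Proof.
  intros Hz Hs.
  pose proof (cayley_boundary_distance zeta s Hz ltac:(lra)) as H.
  assert (Hne : (s + 1)%C <> RtoC 0) by (apply Re_nonzero; simpl; unfold Re in Hs; lra).
  assert (HD : 0 < Cmod (s + 1) ^ 2) by (apply pow_lt, Cmod_gt_0, Hne).
  assert (Hi : 0 < / Cmod (s + 1) ^ 2) by (now apply Rinv_0_lt_compat).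
  assert (H' : / Cmod (s + 1) ^ 2 <= 1 - Cmod (cayley zeta s)).
  { eapply Rle_trans; [|exact H]. unfold Rdiv. nra. }
  apply pow_incr; split.
  - apply Rmult_le_pos; [apply pos_INR|left; apply Rinv_0_lt_compat; lra].
  - apply Rmult_le_compat_l; [apply pos_INR|].
    rewrite <- (Rinv_inv (Cmod (s + 1) ^ 2)). now apply Rinv_le_contravar.
Qed.

Lemma holomorphic_strip_cayley xa xb zeta c :
  0 <= xa + Re c + 1 -> holomorphic_strip xa xb (fun s => cayley zeta (s + c)).
Proof.
  intros Hc.
  replace (fun s => cayley zeta (s + c)) with
    (fun s => zeta * (1 + RtoC (-2) * / (s + (c + 1))))%C.
  - apply holomorphic_strip_mult; [apply holomorphic_strip_const|].
    apply holomorphic_strip_plus; [apply holomorphic_strip_const|].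
    apply holomorphic_strip_mult; [apply holomorphic_strip_const|].
    apply holomorphic_strip_inv_shift.
    intros x y Hx; apply Re_nonzero; simpl; unfold Re in Hc; lra.
  - apply functional_extensionality; intros s; unfold cayley.
    now rewrite Cplus_assoc.
Qed.

Lemma holomorphic_strip_taylor_partial xa xb f n G :
  holomorphic_strip xa xb G -> holomorphic_strip xa xb (fun s => taylor_partial f n (G s)).
Proof.
  intros HG; apply (holomorphic_strip_sum xa xb (fun k s => taylor_coef f k * G s ^ k)%C).
  intros k; apply holomorphic_strip_mult; [apply holomorphic_strip_const|].
  now apply holomorphic_strip_pow.
Qed.

(* The exponent [2 * S p + 2] makes the kernel decay two powers faster than functions of the
   space grow, so that their product is dominated by [/ (4 + y ^ 2)]. *)
Lemma kernel_line_decay t p x y :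
  0 <= t -> x <= 1 ->
  (Cmod (2, y) ^ 2) ^ S p * Cmod (kernel t (2 * S p + 2) (x, y))
    <= exp (t * x) * / (4 + y ^ 2).
Proof.
  intros Ht Hx.
  assert (E : Cmod (2, y) ^ 2 = 4 + y ^ 2) by (rewrite Cmod2_alt; simpl; ring).
  assert (Hpos : 0 < Cmod (2, y)).
  { apply Cmod_gt_0, Re_nonzero; simpl; lra. }
  assert (Hle : Cmod (2, y) <= Cmod ((x, y) + RtoC (-3))).
  { apply Rsqr_incr_0_var; [|apply Cmod_ge_0].
    rewrite !Rsqr_pow2, !Cmod2_alt; simpl; nra. }
  pose proof (Cmod_kernel_le t (2 * S p + 2) (x, y) _ Hpos Hle) as HK.
  rewrite <- E.
  replace (exp (t * x) * / Cmod (2, y) ^ 2) with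
    ((Cmod (2, y) ^ 2) ^ S p * (exp (t * x) / Cmod (2, y) ^ (2 * S p + 2))).
  - apply Rmult_le_compat_l; [apply pow_le, pow_le, Cmod_ge_0|exact HK].
  - rewrite pow_add, <- pow_mult.
    assert (Hq : 0 < Cmod (2, y) ^ (2 * S p)) by now apply pow_lt.
    set (q := Cmod (2, y) ^ (2 * S p)) in *.
    field; split; lra.
Qed.

Lemma shifted_partial_le nu p zeta c f n s :
  Cmod zeta = 1 -> - nu <= INR p -> dirichlet_space nu f -> 1 <= Re s + Re c ->
  Cmod (taylor_partial f n (cayley zeta (s + c)))
    <= dirichlet_norm nu f * (INR (S p) * Cmod (s + c + 1) ^ 2) ^ S p.
Proof.
  intros Hz Hp Hf Hs.
  assert (Hsc : 1 <= Re (s + c)) by exact Hs.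
  eapply Rle_trans.
  { apply (taylor_partial_le nu p); try assumption. apply cayley_disk; [exact Hz|lra]. }
  apply Rmult_le_compat_l; [apply dirichlet_norm_nonneg|].
  now apply growth_weight_cayley_le.
Qed.

Section ShiftedIntegral.

(** In the application [c] is n a and [mu] is lambda^n for the n-th iterate, whereas [n] here is the
    degree of the Taylor polynomial. Moving the line to Re s = 1 - Re c brings s + c back to the
    line of real part 1. *)
Variables (nu : R) (p : nat) (zeta c mu : C) (t : R) (f : C -> C) (n : nat).
Hypotheses (Hzeta : Cmod zeta = 1) (Hp : - nu <= INR p) (Ht : 0 <= t)
  (Hc : 0 <= Re c) (Hf : dirichlet_space nu f).

Let k := (2 * S p + 2)%nat.
Let M := Cmod mu * dirichlet_norm nu f.
Let G (s : C) : C := (mu * taylor_partial f n (cayley zeta (s + c)) * kernel t k s)%C.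

Lemma holomorphic_strip_shifted : holomorphic_strip (- Re c) 2 G.
Proof.
  apply holomorphic_strip_mult; [|apply holomorphic_strip_kernel; lra].
  apply holomorphic_strip_mult; [apply holomorphic_strip_const|].
  apply holomorphic_strip_taylor_partial, holomorphic_strip_cayley; lra.
Qed.

Lemma shifted_scale_nonneg : 0 <= M.
Proof. apply Rmult_le_pos; [apply Cmod_ge_0|apply dirichlet_norm_nonneg]. Qed.

(** Here |s + c + 1| <= 2 r and |s - 3| >= r; the former produces the constant 4 (p + 1), and the
    two spare powers of the kernel leave 1 / r^2. *)
Lemma shifted_horizontal_le r x y :
  2 + Re c + Rabs (Im c) <= r -> 1 - Re c <= x <= 1 -> Rabs y = r ->
  Cmod (G (x, y)) <= M * (4 * INR (S p)) ^ S p * exp t / r ^ 2.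
Proof.
  intros Hr Hx Hy. pose proof (Rabs_pos (Im c)) as Habs.
  assert (H1 : Cmod ((x, y) + c + 1) <= 2 * r).
  { destruct c as [c1 c2]; simpl in *. unfold Cplus; simpl.
    eapply Rle_trans; [apply Cmod_triangle_abs|].
    rewrite (Rabs_right (x + c1 + 1)) by lra.
    pose proof (Rabs_triang (y + c2) 0) as T1. pose proof (Rabs_triang y c2) as T2.
    rewrite Rabs_R0, !Rplus_0_r in *. lra. }
  assert (H2 : r <= Cmod ((x, y) + RtoC (-3))).
  { eapply Rle_trans; [|apply im_le_Cmod]; simpl. rewrite Rplus_0_r; lra. }
  pose proof (Cmod_kernel_le t k (x, y) r ltac:(lra) H2) as HK.
  pose proof (shifted_partial_le nu p zeta c f n (x, y) Hzeta Hp Hf ltac:(simpl; lra)) as HT.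
  assert (H3 : (INR (S p) * Cmod ((x, y) + c + 1) ^ 2) ^ S p <= (4 * INR (S p)) ^ S p * r ^ (2 * S p)).
  { rewrite pow_mult, <- Rpow_mult_distr. apply pow_incr; split.
    - apply Rmult_le_pos; [apply pos_INR|apply pow2_ge_0].
    - replace (4 * INR (S p) * r ^ 2) with (INR (S p) * (2 * r) ^ 2) by ring.
      apply Rmult_le_compat_l; [apply pos_INR|].
      apply pow_incr; split; [apply Cmod_ge_0|exact H1]. }
  unfold G; rewrite !Cmod_mult.
  apply Rle_trans with
    (Cmod mu * (dirichlet_norm nu f * ((4 * INR (S p)) ^ S p * r ^ (2 * S p))) * (exp t / r ^ k)).
  - apply Rmult_le_compat.
    + apply Rmult_le_pos; apply Cmod_ge_0.
    + apply Cmod_ge_0.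
    + apply Rmult_le_compat_l; [apply Cmod_ge_0|].
      eapply Rle_trans; [exact HT|].
      apply Rmult_le_compat_l; [apply dirichlet_norm_nonneg|exact H3].
    + eapply Rle_trans; [exact HK|].
      apply Rmult_le_compat_r; [left; apply Rinv_0_lt_compat, pow_lt; lra|].
      apply exp_le; simpl; nra.
  - right. unfold k, M; rewrite pow_add.
    assert (0 < r ^ (2 * S p)) by (apply pow_lt; lra).
    set (q := r ^ (2 * S p)) in *. set (w := (4 * INR (S p)) ^ S p).
    field; lra.
Qed.

(** On this line s + c + 1 = 2 + i (y + Im c). Replacing it by 2 + i y costs a factor 1 + |Im c| per
    power, which is only polynomial in the number of iterations. *)
Lemma shifted_vertical_le y :
  Cmod (G (1 - Re c, y)) <=
  M * INR (S p) ^ S p * (1 + Rabs (Im c)) ^ (2 * S p) * exp (t * (1 - Re c)) * / (4 + y ^ 2).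
Proof.
  pose proof (Rabs_pos (Im c)) as Habs.
  pose proof (kernel_line_decay t p (1 - Re c) y Ht ltac:(lra)) as HK.
  pose proof (shifted_partial_le nu p zeta c f n (1 - Re c, y) Hzeta Hp Hf ltac:(simpl; lra)) as HT.
  assert (H1 : Cmod ((1 - Re c, y) + c + 1) <= (1 + Rabs (Im c)) * Cmod (2, y)).
  { replace (((1 - Re c)%R, y) + c + 1)%C with ((2, y) + Ci * RtoC (Im c))%C
      by (apply injective_projections; unfold Re, Im; simpl; ring).
    eapply Rle_trans; [apply Cmod_triangle|].
    rewrite Cmod_mult, Cmod_Ci, Cmod_R.
    assert (2 <= Cmod (2, y)).
    { eapply Rle_trans; [|apply re_le_Cmod]; simpl; apply Rle_abs. }
    nra. }
  set (b := 1 + Rabs (Im c)) in *. set (q := Cmod (2, y)) in *.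
  assert (H3 : (INR (S p) * Cmod ((1 - Re c, y) + c + 1) ^ 2) ^ S p
               <= INR (S p) ^ S p * b ^ (2 * S p) * (q ^ 2) ^ S p).
  { rewrite (pow_mult b), <- !Rpow_mult_distr. apply pow_incr; split.
    - apply Rmult_le_pos; [apply pos_INR|apply pow2_ge_0].
    - rewrite Rmult_assoc, <- Rpow_mult_distr. apply Rmult_le_compat_l; [apply pos_INR|].
      apply pow_incr; split; [apply Cmod_ge_0|exact H1]. }
  unfold G; rewrite !Cmod_mult.
  apply Rle_trans with
    (Cmod mu * (dirichlet_norm nu f * (INR (S p) ^ S p * b ^ (2 * S p) * (q ^ 2) ^ S p)) *
     Cmod (kernel t k (1 - Re c, y))).
  - apply Rmult_le_compat_r; [apply Cmod_ge_0|].
    apply Rmult_le_compat_l; [apply Cmod_ge_0|].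
    eapply Rle_trans; [exact HT|].
    apply Rmult_le_compat_l; [apply dirichlet_norm_nonneg|exact H3].
  - replace (Cmod mu * (dirichlet_norm nu f * (INR (S p) ^ S p * b ^ (2 * S p) * (q ^ 2) ^ S p)) *
      Cmod (kernel t k (1 - Re c, y))) with
      (M * INR (S p) ^ S p * b ^ (2 * S p) * ((q ^ 2) ^ S p * Cmod (kernel t k (1 - Re c, y))))
      by (unfold M; ring).
    rewrite (Rmult_assoc (M * INR (S p) ^ S p * b ^ (2 * S p))).
    apply Rmult_le_compat_l; [|exact HK].
    apply Rmult_le_pos; [apply Rmult_le_pos|apply pow_le; unfold b; lra].
    + apply shifted_scale_nonneg.
    + apply pow_le, pos_INR.
Qed.

Lemma shifted_integral_le r :
  2 + Re c + Rabs (Im c) <= r ->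
  Rabs (RInt (fun y => Re (G (1, y))) (- r) r) <=
  2 * (M * INR (S p) ^ S p * (1 + Rabs (Im c)) ^ (2 * S p) * exp (t * (1 - Re c)))
  + 2 * (M * (4 * INR (S p)) ^ S p * exp t / r ^ 2) * Re c.
Proof.
  intros Hr. pose proof (Rabs_pos (Im c)) as Habs.
  assert (H1 : Rabs (RInt (fun y => Re (G (1, y))) (- r) r -
                     RInt (fun y => Re (G (1 - Re c, y))) (- r) r)
    <= 2 * (M * (4 * INR (S p)) ^ S p * exp t / r ^ 2) * (1 - (1 - Re c))).
  { apply (vertical_line_shift (- Re c) 2); try lra.
    - apply holomorphic_strip_shifted.
    - intros x Hx; split; apply shifted_horizontal_le; try assumption;
        rewrite ?Rabs_Ropp; apply Rabs_right; lra. }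
  assert (H2 : Rabs (RInt (fun y => Re (G (1 - Re c, y))) (- r) r) <=
    2 * (M * INR (S p) ^ S p * (1 + Rabs (Im c)) ^ (2 * S p) * exp (t * (1 - Re c)))).
  { apply RInt_le_inv_4_sqr; [lra| | |].
    - apply Rmult_le_pos; [|left; apply exp_pos].
      apply Rmult_le_pos; [apply Rmult_le_pos|apply pow_le; lra].
      + apply shifted_scale_nonneg.
      + apply pow_le, pos_INR.
    - apply (holomorphic_strip_ex_RInt (- Re c) 2 G); [apply holomorphic_strip_shifted|lra].
    - intros y _; eapply Rle_trans; [apply re_le_Cmod|apply shifted_vertical_le]. }
  replace (1 - (1 - Re c)) with (Re c) in H1 by ring.
  set (X := RInt (fun y => Re (G (1, y))) (- r) r) in *.
  set (Y := RInt (fun y => Re (G (1 - Re c, y))) (- r) r) in *.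
  replace X with ((X - Y) + Y) by ring.
  eapply Rle_trans; [apply Rabs_triang|]. lra.
Qed.

End ShiftedIntegral.

(** Here [g] is the deviation of an iterate from the test function. The integrands differ by mu (F -
    T) - g times the kernel, T being the Taylor polynomial: the first part is small by the choice of
    degree, the second is controlled by the norm of [g]. *)
Lemma kernel_pairing_approx nu p zeta c mu t f g r eta :
  Cmod zeta = 1 -> - nu <= INR p -> 0 <= t -> 0 <= Re c -> 0 < eta -> 0 <= r ->
  dirichlet_space nu f -> dirichlet_space nu g ->
  (forall s, 0 < Re s ->
     g (cayley zeta s) = mu * f (cayley zeta (s + c)) - / (s + 1))%C ->
  exists n,
    Rabs (kernel_pairing t (2 * S p + 2) r -
          RInt (fun y => Re (mu * taylor_partial f n (cayley zeta ((1, y) + c)) *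
                  kernel t (2 * S p + 2) (1, y))%C) (- r) r)
    <= 2 * (exp t * (dirichlet_norm nu g * INR (S p) ^ S p + eta)).
Proof.
  intros Hz Hp Ht Hc Heta Hr Hf Hg E.
  set (k := (2 * S p + 2)%nat).
  (* [D] bounds |s + c + 1| on the segment of integration, whose image therefore lies in the disk of
     radius 1 - 1 / D^2. *)
  set (D := 2 + Re c + (r + Rabs (Im c))).
  assert (HD : 2 <= D) by (unfold D; pose proof (Rabs_pos (Im c)); lra).
  assert (HD2 : 0 < / D ^ 2 <= / 4).
  { split; [apply Rinv_0_lt_compat; nra|apply Rinv_le_contravar; nra]. }
  (* The [+ 1] allows mu = 0, that is lambda = 0. *)
  set (e := eta / (Cmod mu + 1)).
  assert (Hmu : 0 <= Cmod mu) by apply Cmod_ge_0.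
  assert (He : 0 < e) by (apply Rdiv_lt_0_compat; lra).
  destruct (taylor_partial_uniform nu p f (1 - / D ^ 2) e Hf Hp ltac:(lra) He) as [n Hn].
  exists n.
  assert (Hunif : forall y, - r <= y <= r ->
    Cmod (mu * (f (cayley zeta ((1, y) + c)) - taylor_partial f n (cayley zeta ((1, y) + c)))) <= eta).
  { intros y Hy. rewrite Cmod_mult.
    assert (Hr1 : 0 < Re ((1, y) + c)) by (simpl; unfold Re in Hc; lra).
    assert (Hcl : Cmod (cayley zeta ((1, y) + c)) <= 1 - / D ^ 2).
    { pose proof (cayley_boundary_distance zeta _ Hz Hr1) as HB.
      assert (Hne : Cmod ((1, y) + c + 1) <= D).
      { destruct c as [c1 c2]; unfold D; simpl in *; unfold Cplus; simpl.
        eapply Rle_trans; [apply Cmod_triangle_abs|].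
        rewrite (Rabs_right (1 + c1 + 1)) by lra.
        pose proof (Rabs_triang y c2) as T.
        assert (Rabs y <= r) by (apply Rabs_le; lra).
        rewrite Rplus_0_r; lra. }
      assert (Hpos : 0 < Cmod ((1, y) + c + 1)).
      { apply Cmod_gt_0, Re_nonzero; simpl; unfold Re in Hc; lra. }
      assert (H2 : / D ^ 2 <= / Cmod ((1, y) + c + 1) ^ 2).
      { apply Rinv_le_contravar; [now apply pow_lt|]. apply pow_incr; lra. }
      assert (1 <= Re ((1, y) + c)) by (simpl; unfold Re in Hc; lra).
      assert (0 < / Cmod ((1, y) + c + 1) ^ 2) by (apply Rinv_0_lt_compat; now apply pow_lt).
      unfold Rdiv in HB. nra. }
    specialize (Hn _ Hcl).
    apply Rle_trans with (Cmod mu * e); [now apply Rmult_le_compat_l|].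
    unfold e; apply (Rmult_le_reg_r (Cmod mu + 1)); [lra|].
    replace (Cmod mu * (eta / (Cmod mu + 1)) * (Cmod mu + 1)) with (Cmod mu * eta) by (field; lra).
    nra. }
  unfold kernel_pairing; fold k.
  rewrite <- (RInt_minus (V := R_CompleteNormedModule)).
  2: apply ex_RInt_kernel_pairing.
  2: { apply (holomorphic_strip_ex_RInt (- Re c) 2 _ 1 (- r) r
         (holomorphic_strip_shifted p zeta c mu t f n)); lra. }
  apply RInt_le_inv_4_sqr; [exact Hr| | |].
  { apply Rmult_le_pos; [left; apply exp_pos|].
    apply Rplus_le_le_0_compat; [|lra].
    apply Rmult_le_pos; [apply dirichlet_norm_nonneg|apply pow_le, pos_INR]. }
  { apply (ex_RInt_minus (V := R_NormedModule)); [apply ex_RInt_kernel_pairing|].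
    apply (holomorphic_strip_ex_RInt (- Re c) 2 _ 1 (- r) r
         (holomorphic_strip_shifted p zeta c mu t f n)); lra. }
  intros y Hy.
  specialize (Hunif y Hy).
  specialize (E (1, y) ltac:(simpl; lra)).
  pose proof (kernel_line_decay t p 1 y Ht ltac:(lra)) as HK; fold k in HK.
  assert (HG : Cmod (g (cayley zeta (1, y))) <=
            dirichlet_norm nu g * (INR (S p) ^ S p * (Cmod (2, y) ^ 2) ^ S p)).
  { eapply Rle_trans; [apply (evaluation_le nu p); try assumption|].
    - apply cayley_disk; [exact Hz|simpl; lra].
    - apply Rmult_le_compat_l; [apply dirichlet_norm_nonneg|].
      rewrite <- Rpow_mult_distr.
      replace (2, y) with ((1, y) + 1)%C by (apply injective_projections; simpl; ring).
      apply growth_weight_cayley_le; [exact Hz|simpl; lra]. }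
  set (T := taylor_partial f n (cayley zeta ((1, y) + c))) in *.
  set (F := f (cayley zeta ((1, y) + c))) in *.
  set (K := kernel t k (1, y)) in *.
  set (g0 := g (cayley zeta (1, y))) in *.
  change (Rabs (Re ((/ ((1, y) + 1) * K) - (mu * T * K))%C)
    <= exp t * (dirichlet_norm nu g * INR (S p) ^ S p + eta) * / (4 + y ^ 2)).
  eapply Rle_trans; [apply re_le_Cmod|].
  replace (/ ((1, y) + 1) * K - mu * T * K)%C with
    ((- g0 + mu * (F - T)) * K)%C by (rewrite E; ring).
  rewrite Cmod_mult.
  (* Since Q >= 1, the constant error [eta] fits under the same weight as [g]. *)
  assert (HQ : 1 <= (Cmod (2, y) ^ 2) ^ S p).
  { apply pow_R1_Rle. rewrite Cmod2_alt; simpl; nra. }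
  set (Q := (Cmod (2, y) ^ 2) ^ S p) in *.
  set (A := dirichlet_norm nu g * INR (S p) ^ S p).
  assert (HA : 0 <= A).
  { apply Rmult_le_pos; [apply dirichlet_norm_nonneg|apply pow_le, pos_INR]. }
  apply Rle_trans with ((A + eta) * Q * Cmod K).
  - apply Rmult_le_compat_r; [apply Cmod_ge_0|].
    eapply Rle_trans; [apply Cmod_triangle|]. rewrite Cmod_opp.
    rewrite <- Rmult_assoc in HG; fold A in HG. nra.
  - rewrite Rmult_assoc, (Rmult_comm (exp t)), (Rmult_assoc (A + eta)).
    apply Rmult_le_compat_l; [lra|].
    rewrite Rmult_1_r in HK; exact HK.
Qed.

(** * Absence of returns *)

(** L is bounded below on the test function, while on the iterate it is at most a constant times
    2^(-n) times the norm of [f]; the gap must be filled by [g]. What matters is that [delta] is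
    uniform in [n], [f] and [g]. *)
Lemma return_distance_lower_bound nu p zeta a lambda :
  Cmod zeta = 1 -> 0 < Re a -> - nu <= INR p ->
  exists delta, 0 < delta /\ forall n f g,
    dirichlet_space nu f -> dirichlet_space nu g ->
    (forall s, 0 < Re s ->
       g (cayley zeta s) =
       lambda ^ n * f (cayley zeta (s + RtoC (INR n) * a)) - / (s + 1))%C ->
    delta <= dirichlet_norm nu g + dirichlet_norm nu f * (/ 2) ^ n.
Proof.
  intros Hz Ha Hp.
  (* The n-th power of [X] dominates |lambda|^n together with the polynomial factor (1 + n |Im
     a|)^(2 (p + 1)). *)
  set (X := Cmod lambda * exp (INR (2 * S p) * Rabs (Im a))).
  assert (HX : 0 <= X) by (apply Rmult_le_pos; [apply Cmod_ge_0|left; apply exp_pos]).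
  (* Then t Re a = 2 X, and X exp(-2 X) <= 1/2 because 1 + 2 X <= exp(2 X). *)
  set (t := 2 * X / Re a).
  assert (Ht : 0 <= t) by (apply Rmult_le_pos; [lra|left; now apply Rinv_0_lt_compat]).
  assert (HXt : X * exp (- (t * Re a)) <= / 2).
  { replace (t * Re a) with (2 * X) by (unfold t; field; lra).
    rewrite exp_Ropp. pose proof (one_plus_le_exp (2 * X)) as H.
    apply (Rmult_le_reg_r (exp (2 * X))); [apply exp_pos|].
    rewrite Rmult_assoc, Rinv_l by (apply Rgt_not_eq, exp_pos). lra. }
  destruct (kernel_pairing_lower_bound t (2 * S p + 2) Ht ltac:(lia)) as [c0 [r0 [Hc0 Hlow]]].
  assert (HPP : 0 < INR (S p) ^ S p) by (apply pow_lt, lt_0_INR; lia).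
  assert (Hexp : 0 < exp t) by apply exp_pos.
  set (B := 2 * exp t * INR (S p) ^ S p).
  assert (HB : 0 < B) by (unfold B; nra).
  exists (c0 / B); split; [now apply Rdiv_lt_0_compat|].
  intros n f g Hf Hg E.
  apply (Rmult_le_reg_r B); [exact HB|].
  replace (c0 / B * B) with c0 by (field; lra).
  (* Half of [eta] pays for the Taylor approximation and half for the horizontal sides. The height
     [r] and the degree may depend on [n], [f] and [eta], since neither enters the conclusion. *)
  apply le_epsilon; intros eta Heta.
  set (c := (RtoC (INR n) * a)%C) in *.
  assert (Ec1 : Re c = Re a * INR n) by (unfold c, Re; simpl; ring).
  assert (Ec2 : Im c = Im a * INR n) by (unfold c, Im; simpl; ring).
  assert (Hc : 0 <= Re c) by (rewrite Ec1; apply Rmult_le_pos; [lra|apply pos_INR]).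
  set (M := Cmod (lambda ^ n) * dirichlet_norm nu f).
  assert (HM : 0 <= M) by (apply Rmult_le_pos; [apply Cmod_ge_0|apply dirichlet_norm_nonneg]).
  set (D := M * (4 * INR (S p)) ^ S p * exp t * Re c).
  assert (HD : 0 <= D).
  { unfold D; apply Rmult_le_pos; [|exact Hc]. apply Rmult_le_pos; [|lra].
    apply Rmult_le_pos; [exact HM|]. apply pow_le; pose proof (pos_INR (S p)); lra. }
  set (r := Rmax (Rmax r0 (2 + Re c + Rabs (Im c))) (4 * D / eta)).
  assert (R1 : r0 <= r) by (eapply Rle_trans; [|apply Rmax_l]; apply Rmax_l).
  assert (R2 : 2 + Re c + Rabs (Im c) <= r) by (eapply Rle_trans; [|apply Rmax_l]; apply Rmax_r).
  assert (R3 : 4 * D / eta <= r) by apply Rmax_r.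
  pose proof (Rabs_pos (Im c)) as Habs.
  assert (Heta' : 0 < eta / (4 * exp t)) by (apply Rdiv_lt_0_compat; lra).
  destruct (kernel_pairing_approx nu p zeta c (lambda ^ n) t f g r (eta / (4 * exp t))
              Hz Hp Ht Hc Heta' ltac:(lra) Hf Hg E) as [N HN].
  pose proof (shifted_integral_le nu p zeta c (lambda ^ n) t f N Hz Hp Ht Hc Hf r R2) as HS.
  cbv zeta in HS. fold M in HS.
  specialize (Hlow r R1).
  set (x := kernel_pairing t (2 * S p + 2) r) in *.
  match type of HS with Rabs ?i <= _ => set (y := i) in * end.
  assert (H1 : M * INR (S p) ^ S p * (1 + Rabs (Im c)) ^ (2 * S p) * exp (t * (1 - Re c))
     <= exp t * INR (S p) ^ S p * (dirichlet_norm nu f * (/ 2) ^ n)).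
  { replace (t * (1 - Re c)) with (t + (- (t * Re a)) * INR n) by (rewrite Ec1; ring).
    rewrite exp_plus, exp_mult_INR.
    unfold M; rewrite Cmod_pow.
    assert (H2 : (1 + Rabs (Im c)) ^ (2 * S p) <= exp (INR (2 * S p) * Rabs (Im a)) ^ n).
    { rewrite <- exp_mult_INR.
      replace (INR (2 * S p) * Rabs (Im a) * INR n) with (Rabs (Im c) * INR (2 * S p)).
      - rewrite exp_mult_INR. apply pow_incr; split; [lra|apply one_plus_le_exp].
      - rewrite Ec2, Rabs_mult, (Rabs_right (INR n)) by (apply Rle_ge, pos_INR); ring. }
    assert (H3 : Cmod lambda ^ n * (1 + Rabs (Im c)) ^ (2 * S p) * exp (- (t * Re a)) ^ n <= (/ 2) ^ n).
    { apply Rle_trans with ((X * exp (- (t * Re a))) ^ n).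
      - unfold X; rewrite !Rpow_mult_distr.
        apply Rmult_le_compat_r; [apply pow_le; left; apply exp_pos|].
        apply Rmult_le_compat_l; [apply pow_le, Cmod_ge_0|exact H2].
      - apply pow_incr; split; [apply Rmult_le_pos; [exact HX|left; apply exp_pos]|exact HXt]. }
    apply Rle_trans with (exp t * INR (S p) ^ S p * (dirichlet_norm nu f *
       (Cmod lambda ^ n * (1 + Rabs (Im c)) ^ (2 * S p) * exp (- (t * Re a)) ^ n))); [right; ring|].
    apply Rmult_le_compat_l; [nra|].
    apply Rmult_le_compat_l; [apply dirichlet_norm_nonneg|exact H3]. }
  assert (H4 : 2 * (M * (4 * INR (S p)) ^ S p * exp t / r ^ 2) * Re c <= eta / 2).
  { replace (2 * (M * (4 * INR (S p)) ^ S p * exp t / r ^ 2) * Re c) with (2 * D / r ^ 2)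
      by (unfold D; field; lra).
    apply (Rmult_le_reg_r (r ^ 2)); [apply pow_lt; lra|].
    replace (2 * D / r ^ 2 * r ^ 2) with (2 * D) by (field; lra).
    apply (Rmult_le_compat_r eta) in R3; [|lra].
    replace (4 * D / eta * eta) with (4 * D) in R3 by (field; lra). nra. }
  assert (H5 : 2 * (exp t * (dirichlet_norm nu g * INR (S p) ^ S p + eta / (4 * exp t)))
     = 2 * exp t * INR (S p) ^ S p * dirichlet_norm nu g + eta / 2) by (field; lra).
  rewrite H5 in HN.
  assert (H6 : Rabs x <= Rabs (x - y) + Rabs y).
  { replace x with ((x - y) + y) at 1 by ring; apply Rabs_triang. }
  unfold B. lra.
Qed.

(* The function [/ (s + 1)] in the half-plane coordinate. *)
Definition test_function (zeta z : C) : C := (RtoC (/ 2) * (1 - Cconj zeta * z))%C.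

Lemma test_function_cayley zeta s :
  Cmod zeta = 1 -> 0 < Re s -> test_function zeta (cayley zeta s) = (/ (s + 1))%C.
Proof.
  intros Hz Hs.
  assert (E : (zeta * Cconj zeta)%C = RtoC 1) by (rewrite <- Cmod2_conj, Hz; f_equal; ring).
  unfold test_function, cayley.
  transitivity (RtoC (/ 2) * (1 - (zeta * Cconj zeta) * (1 + RtoC (-2) * / (s + 1))))%C; [ring|].
  rewrite E.
  transitivity (- (RtoC (/ 2) * RtoC (-2)) * / (s + 1))%C; [ring|].
  replace (RtoC (/ 2) * RtoC (-2))%C with (- (1))%C by (apply injective_projections; simpl; field).
  ring.
Qed.

Lemma test_function_taylor zeta :
  taylor_series (test_function zeta)
    (fun n => match n with O => RtoC (/ 2) | S O => (- (RtoC (/ 2) * Cconj zeta))%C | _ => RtoC 0 end).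
Proof.
  intros z _; unfold is_pseries.
  match goal with |- is_series ?u _ =>
    replace (test_function zeta z) with (sum_n u 1) end.
  - apply is_series_eventually_zero; intros [|[|k]] Hk; try lia.
    apply (scal_zero_r (V := C_NormedModule)).
  - rewrite sum_Sn, sum_O, !pow_n_Cpow. unfold plus, scal; simpl; unfold mult; simpl.
    unfold test_function, one; simpl. match goal with |- ?l = ?r => change (@eq C l r) end. ring.
Qed.

Lemma test_function_dirichlet_space nu zeta : dirichlet_space nu (test_function zeta).
Proof.
  split; [eexists; apply test_function_taylor|].
  eexists; apply (is_series_eventually_zero (V := R_NormedModule)) with (n := 1%nat).
  intros k Hk; unfold dirichlet_term.
  rewrite (taylor_coef_unique _ _ (test_function_taylor zeta)).
  destruct k as [|[|k]]; try lia. rewrite Cmod_0; unfold zero; simpl; ring.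
Qed.

(** Vanishing would mean mu (s + 1) = s + a + 1. The real parts of this at s = 1 and s = 3 force Re
    a = 0. *)
Lemma test_function_not_returning (a mu : C) :
  0 < Re a ->
  exists s : C, 0 < Re s /\ (mu * / (s + a + 1) - / (s + 1))%C <> RtoC 0.
Proof.
  intros Ha.
  assert (Hne : forall x, 0 < x -> (RtoC x + a + 1)%C <> RtoC 0 /\ (RtoC x + 1)%C <> RtoC 0).
  { intros x Hx; split; apply Re_nonzero; simpl; unfold Re in Ha; lra. }
  assert (Hm : forall x, 0 < x -> (mu * / (RtoC x + a + 1) - / (RtoC x + 1))%C = RtoC 0 ->
            (mu * (RtoC x + 1))%C = (RtoC x + a + 1)%C).
  { intros x Hx E. destruct (Hne x Hx) as [H1 H2].
    transitivity ((mu * / (RtoC x + a + 1) - / (RtoC x + 1)) * (RtoC x + a + 1) * (RtoC x + 1) +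
      (RtoC x + a + 1))%C; [field; tauto|]. rewrite E; ring. }
  destruct (Ceq_dec (mu * / (RtoC 1 + a + 1) - / (RtoC 1 + 1)) 0) as [E1|E1].
  2: { exists (RtoC 1); split; [simpl; lra|exact E1]. }
  exists (RtoC 3); split; [simpl; lra|intros E3].
  apply Hm in E1; [|lra]. apply Hm in E3; [|lra].
  apply (f_equal Re) in E1; apply (f_equal Re) in E3.
  destruct mu as [m1 m2], a as [a1 a2]; simpl in *. lra.
Qed.

(** At a point where the test function fails to return, the nonzero defect v is a combination of
    values of [g] and f - f0, both small by [evaluation_le]. The threshold depends on [a] and [mu],
    hence on the iterate, so this serves finitely many iterates only. *)
Lemma fixed_time_not_returning nu p zeta a mu :
  Cmod zeta = 1 -> 0 < Re a -> - nu <= INR p ->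
  exists d, 0 < d /\ forall f g,
    dirichlet_space nu f -> dirichlet_space nu g ->
    dirichlet_norm nu (fun z => f z - test_function zeta z)%C < d ->
    dirichlet_norm nu g < d ->
    ~ (forall s, 0 < Re s ->
       g (cayley zeta s) = mu * f (cayley zeta (s + a)) - / (s + 1))%C.
Proof.
  intros Hz Ha Hp.
  destruct (test_function_not_returning a mu Ha) as [s [Hs Hv]].
  set (v := (mu * / (s + a + 1) - / (s + 1))%C) in *.
  assert (Hsa : 0 < Re (s + a)) by (simpl; unfold Re in *; lra).
  pose proof (cayley_disk zeta s Hz Hs) as D1.
  pose proof (cayley_disk zeta (s + a) Hz Hsa) as D2.
  set (w := fun z => (INR (S p) / (1 - Cmod z)) ^ S p).
  assert (Hw : forall z, disk z -> 0 <= w z).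
  { intros z Hd; unfold disk in Hd; apply pow_le.
    apply Rmult_le_pos; [apply pos_INR|left; apply Rinv_0_lt_compat; lra]. }
  pose proof (Hw _ D1) as W1. pose proof (Hw _ D2) as W2.
  pose proof (Cmod_ge_0 mu) as Hmu.
  set (L := w (cayley zeta s) + Cmod mu * w (cayley zeta (s + a))).
  assert (HL : 0 <= L) by (unfold L; nra).
  apply Cmod_gt_0 in Hv.
  (* The contradiction is |v| <= d L < d (L + 1) = |v|. *)
  exists (Cmod v / (L + 1)); split; [apply Rdiv_lt_0_compat; lra|].
  intros f g Hf Hg Hfd Hgd E.
  set (d := Cmod v / (L + 1)) in *.
  set (f0 := test_function zeta) in *.
  pose proof (test_function_dirichlet_space nu zeta) as Hf0. fold f0 in Hf0.
  pose proof (evaluation_le nu p g _ Hg Hp D1) as G1. fold (w (cayley zeta s)) in G1.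
  pose proof (evaluation_le nu p _ _ (dirichlet_space_minus _ _ _ Hf Hf0) Hp D2) as G2.
  fold (w (cayley zeta (s + a))) in G2. cbv beta in G2.
  set (N1 := dirichlet_norm nu g) in *.
  set (N2 := dirichlet_norm nu (fun z => f z - f0 z)%C) in *.
  assert (Ev : v = (g (cayley zeta s) + mu * - (f (cayley zeta (s + a)) - f0 (cayley zeta (s + a))))%C).
  { rewrite (E s Hs). unfold f0; rewrite test_function_cayley by assumption. unfold v; ring. }
  assert (HT : Cmod v <= N1 * w (cayley zeta s) + Cmod mu * (N2 * w (cayley zeta (s + a)))).
  { rewrite Ev. eapply Rle_trans; [apply Cmod_triangle|].
    rewrite Cmod_mult, Cmod_opp.
    apply Rplus_le_compat; [exact G1|now apply Rmult_le_compat_l]. }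
  assert (Hd : Cmod v = d * (L + 1)) by (unfold d; field; lra).
  assert (0 < d) by (apply Rdiv_lt_0_compat; lra).
  assert (N1 * w (cayley zeta s) <= d * w (cayley zeta s)) by (apply Rmult_le_compat_r; lra).
  assert (Cmod mu * (N2 * w (cayley zeta (s + a))) <= Cmod mu * (d * w (cayley zeta (s + a)))).
  { apply Rmult_le_compat_l; [exact Hmu|]. apply Rmult_le_compat_r; lra. }
  unfold L in Hd. lra.
Qed.

(** To use only the estimate for differences, f is written as (f - f0) - ((f0 - f0) - f0). *)
Lemma dirichlet_norm_near_le nu f f0 :
  dirichlet_space nu f -> dirichlet_space nu f0 ->
  dirichlet_norm nu (fun z => f z - f0 z)%C <= 1 ->
  dirichlet_norm nu f <= 2 + 2 * dirichlet_norm nu f0.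
Proof.
  intros Hf Hf0 H1.
  pose proof (dirichlet_space_minus nu _ _ Hf Hf0) as A1.
  pose proof (dirichlet_space_minus nu _ _ Hf0 Hf0) as A2.
  pose proof (dirichlet_space_minus nu _ _ A2 Hf0) as A3.
  pose proof (dirichlet_norm_minus_sqr_le nu _ _ A1 A3) as Q1.
  pose proof (dirichlet_norm_minus_sqr_le nu _ _ A2 Hf0) as Q2.
  rewrite dirichlet_norm_self in Q2.
  rewrite (dirichlet_norm_ext _ _ f) in Q1 by (intros z; ring).
  pose proof (dirichlet_norm_nonneg nu (fun z => f z - f0 z)%C).
  pose proof (dirichlet_norm_nonneg nu f).
  pose proof (dirichlet_norm_nonneg nu f0).
  apply Rsqr_incr_0_var; [unfold Rsqr|lra]. cbv beta in *. nra.
Qed.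

(** The index 0 is left out because the zeroth iterate always returns. *)
Lemma finitely_many_thresholds (P : nat -> R -> Prop) :
  (forall n d d', P n d -> 0 < d' -> d' <= d -> P n d') ->
  (forall n, (0 < n)%nat -> exists d, 0 < d /\ P n d) ->
  forall N, exists d, 0 < d /\ forall n, (0 < n <= N)%nat -> P n d.
Proof.
  intros Hmono H N; induction N as [|N [d [Hd IH]]].
  - exists 1; split; [lra|lia].
  - destruct (H (S N) ltac:(lia)) as [d' [Hd' HP]].
    assert (Hmin : 0 < Rmin d d') by now apply Rmin_pos.
    exists (Rmin d d'); split; [exact Hmin|].
    intros n Hn. destruct (Nat.eq_dec n (S N)) as [->|Hne].
    + apply (Hmono _ d'); [exact HP|exact Hmin|apply Rmin_r].
    + apply (Hmono _ d); [apply IH; lia|exact Hmin|apply Rmin_l].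
Qed.

Lemma iter_composition_cayley phi lambda zeta a f n s :
  (forall s, 0 < Re s -> phi (Some (cayley zeta s)) = Some (cayley zeta (s + a))) ->
  0 < Re a -> 0 < Re s ->
  Nat.iter n (scaled lambda (composition_operator phi)) f (cayley zeta s) =
  (lambda ^ n * f (cayley zeta (s + RtoC (INR n) * a)))%C.
Proof.
  intros Hphi Ha; revert s; induction n as [|n IH]; intros s Hs.
  - simpl. replace (s + RtoC 0 * a)%C with s by ring. ring.
  - change (lambda * composition_operator phi
      (Nat.iter n (scaled lambda (composition_operator phi)) f) (cayley zeta s) =
      lambda ^ S n * f (cayley zeta (s + RtoC (INR (S n)) * a)))%C.
    unfold composition_operator at 1. rewrite Hphi by exact Hs.
    rewrite IH by (simpl; unfold Re in *; lra).
    rewrite S_INR, RtoC_plus.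
    replace (s + (RtoC (INR n) + 1) * a)%C with (s + a + RtoC (INR n) * a)%C by ring.
    simpl; ring.
Qed.

Lemma cayley_translation_not_recurrent phi zeta a lambda nu :
  Cmod zeta = 1 -> 0 < Re a ->
  (forall s, 0 < Re s -> phi (Some (cayley zeta s)) = Some (cayley zeta (s + a))) ->
  ~ recurrent nu (scaled lambda (composition_operator phi)).
Proof.
  intros Hz Ha Hphi Hrec.
  destruct (INR_unbounded (- nu)) as [p Hp0].
  assert (Hp : - nu <= INR p) by lra.
  set (f0 := test_function zeta).
  pose proof (test_function_dirichlet_space nu zeta) as Hf0; fold f0 in Hf0.
  destruct (return_distance_lower_bound nu p zeta a lambda Hz Ha Hp) as [delta [Hdelta Hlong]].
  pose proof (dirichlet_norm_nonneg nu f0) as HN0.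
  set (M := 2 + 2 * dirichlet_norm nu f0).
  assert (HM : 0 < M) by (unfold M; lra).
  (* From [N] on, the term with 2^(-n) in [return_distance_lower_bound] is at most delta / 2, as [M]
     bounds the norm of every function within distance 1 of f0. *)
  destruct (pow_lt_1_zero (/ 2) ltac:(rewrite Rabs_right; lra) (delta / (2 * M))
              ltac:(apply Rdiv_lt_0_compat; lra)) as [N HN].
  destruct (finitely_many_thresholds (fun n d => forall f g,
    dirichlet_space nu f -> dirichlet_space nu g ->
    dirichlet_norm nu (fun z => f z - f0 z)%C < d ->
    dirichlet_norm nu g < d ->
    ~ (forall s, 0 < Re s ->
       g (cayley zeta s) =
       lambda ^ n * f (cayley zeta (s + RtoC (INR n) * a)) - / (s + 1))%C)) with (N := N)
    as [d [Hd Hshort]].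
  { intros n d d' H _ Hle f g Hf Hg H1 H2; apply H; try assumption; lra. }
  { intros n Hn; apply (fixed_time_not_returning nu p); try assumption.
    simpl. unfold Re in Ha.
    assert (0 < INR n) by now apply lt_0_INR. nra. }
  (* The bound 1 gives the norm estimate by [M], [d] excludes returns at times up to [N], and delta
     / 2 excludes later ones. *)
  set (eps := Rmin (Rmin 1 d) (delta / 2)).
  assert (Heps : 0 < eps).
  { apply Rmin_pos; [apply Rmin_pos|]; lra. }
  assert (E1 : eps <= 1) by (eapply Rle_trans; [apply Rmin_l|apply Rmin_l]).
  assert (E2 : eps <= d) by (eapply Rle_trans; [apply Rmin_l|apply Rmin_r]).
  assert (E3 : eps <= delta / 2) by apply Rmin_r.
  destruct (Hrec (dirichlet_ball_interior nu f0 eps)) as [n [Hn [f [Uf Uh]]]].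
  { apply dirichlet_ball_interior_open. }
  { exists f0; now apply dirichlet_ball_interior_center. }
  apply dirichlet_ball_interior_subset in Uf. apply dirichlet_ball_interior_subset in Uh.
  destruct Uf as [Hf Nf], Uh as [Hh Nh].
  set (h := Nat.iter n (scaled lambda (composition_operator phi)) f) in *.
  pose proof (dirichlet_space_minus nu _ _ Hh Hf0) as Hg.
  assert (E : forall s, 0 < Re s -> (h (cayley zeta s) - f0 (cayley zeta s) =
       lambda ^ n * f (cayley zeta (s + RtoC (INR n) * a)) - / (s + 1))%C).
  { intros s Hs. unfold h, f0.
    now rewrite (iter_composition_cayley phi lambda zeta a), test_function_cayley. }
  destruct (Nat.le_gt_cases n N) as [Hle|Hlt].
  - apply (Hshort n ltac:(lia) f (fun z => h z - f0 z)%C Hf Hg); [lra|lra|exact E].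
  - pose proof (Hlong n f (fun z => h z - f0 z)%C Hf Hg E) as HL.
    specialize (HN n ltac:(lia)).
    rewrite Rabs_right in HN by (apply Rle_ge, pow_le; lra).
    pose proof (dirichlet_norm_near_le nu f f0 Hf Hf0 ltac:(lra)) as HF; fold M in HF.
    assert (dirichlet_norm nu f * (/ 2) ^ n <= M * (delta / (2 * M))).
    { apply Rmult_le_compat; [apply dirichlet_norm_nonneg|apply pow_le; lra|exact HF|lra]. }
    replace (M * (delta / (2 * M))) with (delta / 2) in * by (field; lra).
    lra.
Qed.

(** * Parabolic self-maps of the disk *)

Lemma quadratic_leading_nonpos A B D :
  (forall n : nat, A * INR n ^ 2 + B * INR n + D <= 0) -> A <= 0.
Proof.
  intros H. destruct (Rle_lt_dec A 0) as [HA|HA]; [exact HA|exfalso].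
  destruct (INR_unbounded ((Rabs B + Rabs D) / A + 1)) as [n Hn].
  specialize (H n).
  assert (HX : 0 <= (Rabs B + Rabs D) / A).
  { apply Rmult_le_pos; [pose proof (Rabs_pos B); pose proof (Rabs_pos D); lra|].
    left; now apply Rinv_0_lt_compat. }
  assert (E : (Rabs B + Rabs D) / A * A = Rabs B + Rabs D) by (field; lra).
  set (X := (Rabs B + Rabs D) / A) in *. set (N := INR n) in *.
  assert (HB : - Rabs B <= B) by (pose proof (Rabs_maj2 B); lra).
  assert (HD : - Rabs D <= D) by (pose proof (Rabs_maj2 D); lra).
  pose proof (Rabs_pos B); pose proof (Rabs_pos D).
  assert (A * N > Rabs B + Rabs D) by nra.
  nra.
Qed.

(* Negative exactly when [zeta + 1 / q] lies in the disk. *)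
Definition disk_form (zeta q : C) : R :=
  (Cmod zeta ^ 2 - 1) * Cmod q ^ 2 + 2 * Re (zeta * q) + 1.

Lemma disk_form_eq zeta q : disk_form zeta q = Cmod (zeta * q + 1) ^ 2 - Cmod q ^ 2.
Proof.
  unfold disk_form; rewrite !Cmod2_alt.
  destruct zeta, q; unfold Re, Im; simpl; ring.
Qed.

Lemma disk_form_disk zeta q :
  q <> RtoC 0 -> disk (zeta + / q)%C <-> disk_form zeta q < 0.
Proof.
  intros Hq. apply Cmod_gt_0 in Hq as Hq'. rewrite disk_form_eq; unfold disk.
  assert (E : Cmod (zeta * q + 1) = Cmod (zeta + / q) * Cmod q).
  { rewrite <- Cmod_mult; f_equal; field; exact Hq. }
  rewrite E, Rpow_mult_distr.
  pose proof (Cmod_ge_0 (zeta + / q)).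
  set (x := Cmod (zeta + / q)) in *. set (y := Cmod q) in *.
  assert (0 < y ^ 2) by now apply pow_lt.
  set (Y := y ^ 2) in *. split; intros Hx.
  { assert (x ^ 2 < 1) by nra. nra. }
  destruct (Rlt_le_dec x 1) as [Hl|Hl]; [exact Hl|exfalso].
  assert (1 <= x ^ 2) by nra. nra.
Qed.

Lemma disk_form_neg_nonzero zeta q : disk_form zeta q < 0 -> q <> RtoC 0.
Proof.
  intros H ->. rewrite disk_form_eq, Cmult_0_r, Cplus_0_l, Cmod_0, Cmod_1 in H. lra.
Qed.

Lemma disk_form_translate zeta q kappa x :
  disk_form zeta (q + RtoC x * kappa) =
  ((Cmod zeta ^ 2 - 1) * Cmod kappa ^ 2) * x ^ 2 +
  2 * ((Cmod zeta ^ 2 - 1) * Re (q * Cconj kappa) + Re (zeta * kappa)) * x + disk_form zeta q.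
Proof.
  unfold disk_form; rewrite !Cmod2_alt.
  destruct zeta, q, kappa; unfold Re, Im; simpl; ring.
Qed.

(* Along an orbit [disk_form zeta] is a quadratic polynomial with leading coefficient
   [(|zeta|^2 - 1) |kappa|^2]; a forward orbit of a point in the region excludes [|zeta| > 1],
   and a backward orbit of a point outside excludes [|zeta| < 1]. *)
Lemma translation_invariant_unit zeta kappa :
  kappa <> RtoC 0 ->
  (forall q, disk_form zeta q < 0 -> disk_form zeta (q + kappa) < 0) ->
  Cmod zeta = 1.
Proof.
  intros Hk Hinv.
  assert (Hk2 : 0 < Cmod kappa ^ 2) by (apply pow_lt, Cmod_gt_0, Hk).
  pose proof (Cmod_ge_0 zeta) as Hz0.
  assert (Hup : Cmod zeta <= 1).
  { destruct (Rle_lt_dec (Cmod zeta) 1) as [H|H]; [exact H|exfalso].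
    assert (Hz : zeta <> RtoC 0) by (apply Cmod_gt_0; lra).
    (* This [q] represents the centre of the disk: zeta + 1 / q = 0. *)
    set (q := (- / zeta)%C).
    assert (Hq : disk_form zeta q < 0).
    { rewrite disk_form_eq. replace (zeta * q + 1)%C with (RtoC 0) by (unfold q; field; exact Hz).
      rewrite Cmod_0. unfold q; rewrite Cmod_opp, Cmod_inv by exact Hz.
      assert (0 < (/ Cmod zeta) ^ 2) by (apply pow_lt, Rinv_0_lt_compat; lra). lra. }
    assert (Hn : forall n : nat, disk_form zeta (q + RtoC (INR n) * kappa) < 0).
    { induction n as [|n IH].
      - simpl. now rewrite Cmult_0_l, Cplus_0_r.
      - rewrite S_INR, RtoC_plus.
        replace (q + (RtoC (INR n) + 1) * kappa)%C with (q + RtoC (INR n) * kappa + kappa)%C by ring.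
        now apply Hinv. }
    assert ((Cmod zeta ^ 2 - 1) * Cmod kappa ^ 2 <= 0).
    { eapply quadratic_leading_nonpos; intros n.
      left; rewrite <- disk_form_translate; apply Hn. }
    assert (0 < Cmod zeta ^ 2 - 1) by nra. nra. }
  assert (Hlow : 1 <= Cmod zeta); [|lra].
  destruct (Rle_lt_dec 1 (Cmod zeta)) as [H|H]; [exact H|exfalso].
  (* The backward orbit starts at q = 0, which represents the point at infinity. *)
  assert (Hn : forall n : nat, 0 <= disk_form zeta (0 + RtoC (INR n) * - kappa)).
  { induction n as [|n IH].
    - simpl. rewrite disk_form_eq, Cmult_0_l, Cplus_0_r, Cmult_0_r, Cplus_0_l, Cmod_0, Cmod_1. lra.
    - apply Rnot_lt_le; intros Hneg. apply Hinv in Hneg.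
      rewrite S_INR, RtoC_plus in Hneg.
      replace (0 + (RtoC (INR n) + 1) * - kappa + kappa)%C with (0 + RtoC (INR n) * - kappa)%C in Hneg by ring.
      lra. }
  assert (- ((Cmod zeta ^ 2 - 1) * Cmod (- kappa) ^ 2) <= 0).
  { eapply quadratic_leading_nonpos; intros n. specialize (Hn n).
    rewrite disk_form_translate in Hn.
    match type of Hn with 0 <= ?A * _ + ?B * _ + ?D =>
      instantiate (2 := - B); instantiate (1 := - D) end.
    lra. }
  rewrite Cmod_opp in *.
  assert (Cmod zeta ^ 2 - 1 < 0) by nra. nra.
Qed.

Lemma translation_not_disk_self_map (beta : C) :
  beta <> RtoC 0 -> (forall z, disk z -> disk (z + beta)%C) -> False.
Proof.
  intros Hb H. apply Cmod_gt_0 in Hb.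
  assert (H0 : Cmod beta < 1).
  { specialize (H (RtoC 0)). unfold disk in H.
    rewrite Cplus_0_l, Cmod_0 in H. apply H; lra. }
  (* The point k beta has modulus 1 - |beta| / 2, and adding beta pushes it out to modulus 1 +
     |beta| / 2. *)
  set (k := / Cmod beta - / 2).
  assert (Ek : k * Cmod beta = 1 - Cmod beta / 2) by (unfold k; field; lra).
  assert (Hk : 0 < k) by nra.
  assert (Hz : disk (RtoC k * beta)).
  { unfold disk; rewrite Cmod_mult, Cmod_R, Rabs_right by lra. lra. }
  specialize (H _ Hz). unfold disk in H.
  replace (RtoC k * beta + beta)%C with (RtoC (k + 1) * beta)%C in H
    by (rewrite RtoC_plus; ring).
  rewrite Cmod_mult, Cmod_R, Rabs_right in H by lra. lra.
Qed.

Lemma linear_fractional_Some a b c d z :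
  (c * z + d)%C <> RtoC 0 ->
  linear_fractional a b c d (Some z) = Some ((a * z + b) / (c * z + d))%C.
Proof. intros H; simpl; destruct (Ceq_dec (c * z + d)%C 0); tauto. Qed.

(** The coordinate q = 1 / (z - zeta) sends the fixed point to infinity; a linear fractional map
    fixing only infinity is a translation. The clause for q + kappa = 0 records the pole, so that
    the self-map property can later exclude it. *)
Lemma parabolic_reciprocal_translation phi :
  parabolic phi -> disk_self_map phi ->
  exists zeta kappa : C, kappa <> RtoC 0 /\
    forall q, q <> RtoC 0 ->
      ((q + kappa)%C <> RtoC 0 -> phi (Some (zeta + / q)%C) = Some (zeta + / (q + kappa))%C) /\
      ((q + kappa)%C = RtoC 0 -> phi (Some (zeta + / q)%C) = None).
Proof.
  intros [[a [b [c [d [Hdet Hphi]]]]] [Hid [w0 [Hfix Huniq]]]] Hself.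
  destruct (Ceq_dec c 0) as [Hc|Hc].
  (* Infinity is fixed and the map is affine: it is the identity, a nontrivial translation, which
     does not preserve the disk, or it has a second, finite fixed point. *)
  - exfalso. subst c.
    assert (Hd : d <> RtoC 0) by (intros ->; apply Hdet; ring).
    assert (Hden : forall z, (0 * z + d)%C <> RtoC 0).
    { intros z; now rewrite Cmult_0_l, Cplus_0_l. }
    assert (HN : phi None = None).
    { rewrite Hphi; simpl; destruct (Ceq_dec 0 0); tauto. }
    assert (HS : forall z, phi (Some z) = Some ((a * z + b) / d)%C).
    { intros z; rewrite Hphi, linear_fractional_Some by apply Hden.
      now rewrite Cmult_0_l, Cplus_0_l. }
    pose proof (Huniq _ HN) as ->.
    destruct (Ceq_dec a d) as [<-|Had].
    + destruct (Ceq_dec b 0) as [->|Hb].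
      * apply Hid; intros [z|]; [|exact HN]. rewrite HS; f_equal; field; exact Hd.
      * apply (translation_not_disk_self_map (b / a)%C).
        { intros E; apply Hb.
          transitivity (b / a * a)%C; [field; exact Hd|rewrite E; ring]. }
        intros z Hz. destruct (Hself z Hz) as [w [Hw E]].
        rewrite HS in E; injection E as E.
        replace (z + b / a)%C with w; [exact Hw|]. rewrite <- E; field; exact Hd.
    + assert (Hda : (d - a)%C <> RtoC 0).
      { intros E; apply Had. transitivity (d - (d - a))%C; [ring|rewrite E; ring]. }
      discriminate (Huniq (Some (b / (d - a))%C)).
      rewrite HS; f_equal; field; tauto.
  - destruct w0 as [zeta|].
    2: { rewrite Hphi in Hfix; simpl in Hfix. destruct (Ceq_dec c 0); [tauto|discriminate]. }
    (* A root of the fixed-point quadratic is a genuine fixed point, since a zero denominator there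
       would make the determinant vanish. *)
    assert (Hroot : forall z, (c * z * z + (d - a) * z - b)%C = RtoC 0 ->
              (c * z + d)%C <> RtoC 0 /\ phi (Some z) = Some z).
    { intros z E.
      assert (Hden : (c * z + d)%C <> RtoC 0).
      { intros E2; apply Hdet.
        transitivity ((a * (c * z + d)) + c * ((c * z * z + (d - a) * z - b) - z * (c * z + d)))%C;
          [ring|rewrite E, E2; ring]. }
      split; [exact Hden|]. rewrite Hphi, linear_fractional_Some by exact Hden. f_equal.
      transitivity (z - (c * z * z + (d - a) * z - b) / (c * z + d))%C; [field; exact Hden|].
      rewrite E; field; exact Hden. }
    assert (Hden : (c * zeta + d)%C <> RtoC 0).
    { intros E. rewrite Hphi in Hfix; simpl in Hfix.
      destruct (Ceq_dec (c * zeta + d)%C 0); [discriminate|tauto]. }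
    assert (Ez : (c * zeta * zeta + (d - a) * zeta - b)%C = RtoC 0).
    { rewrite Hphi, linear_fractional_Some in Hfix by exact Hden. injection Hfix as E.
      transitivity ((zeta - (a * zeta + b) / (c * zeta + d)) * (c * zeta + d))%C;
        [field; exact Hden|rewrite E; ring]. }
    (* By Vieta the left side is the other root of the quadratic, so uniqueness of the fixed point
       makes zeta a double root. *)
    assert (E1 : ((a - d) / c - zeta)%C = zeta).
    { assert (E : (c * ((a - d) / c - zeta) * ((a - d) / c - zeta)
                  + (d - a) * ((a - d) / c - zeta) - b)%C = RtoC 0).
      { rewrite <- Ez; field; exact Hc. }
      destruct (Hroot _ E) as [_ Hf]. apply Huniq in Hf. now injection Hf. }
    set (e := (c * zeta + d)%C) in *.
    assert (Ea : a = (e + c * zeta)%C).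
    { transitivity (c * ((a - d) / c - zeta) + (d + c * zeta))%C; [field; exact Hc|].
      rewrite E1; unfold e; ring. }
    assert (Eb : b = (- (c * zeta * zeta))%C).
    { transitivity ((c * zeta * zeta + (d - a) * zeta) - (c * zeta * zeta + (d - a) * zeta - b))%C; [ring|].
      rewrite Ez, Ea; unfold e; ring. }
    assert (Ed : d = (e - c * zeta)%C) by (unfold e; ring).
    exists zeta, (c / e)%C; split.
    { intros E; apply Hc. transitivity (c / e * e)%C; [field; exact Hden|rewrite E; ring]. }
    intros q Hq.
    assert (EQ : (c * (zeta + / q) + d)%C = (e * (q + c / e) / q)%C).
    { rewrite Ed; field; tauto. }
    split; intros Hqk.
    + assert (Hne : (c * (zeta + / q) + d)%C <> RtoC 0).
      { rewrite EQ. intros E. apply Hqk.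
        transitivity (e * (q + c / e) / q * (q / e))%C; [field; tauto|rewrite E; ring]. }
      assert (Hne2 : (e * q + c)%C <> RtoC 0).
      { intros E; apply Hqk.
        transitivity ((e * q + c) / e)%C; [field; tauto|rewrite E; field; tauto]. }
      rewrite Hphi, linear_fractional_Some by exact Hne. f_equal.
      rewrite EQ, Ea, Eb. field. rewrite (Cmult_comm q e); tauto.
    + rewrite Hphi; simpl. destruct (Ceq_dec (c * (zeta + / q) + d)%C 0) as [E|E]; [reflexivity|].
      exfalso; apply E. rewrite EQ, Hqk. field; exact Hq.
Qed.

(** Links the half-plane coordinate s with the coordinate q = 1 / (z - zeta) in which the map is a
    translation. *)
Lemma cayley_reciprocal zeta s :
  zeta <> RtoC 0 -> (s + 1)%C <> RtoC 0 ->
  cayley zeta s = (zeta + / (- ((s + 1) / (RtoC 2 * zeta))))%C.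
Proof.
  intros Hz Hs; unfold cayley.
  replace (RtoC (-2)) with (- RtoC 2)%C by (apply injective_projections; simpl; ring).
  assert (RtoC 2 <> RtoC 0) by (apply Re_nonzero; simpl; lra).
  field; tauto.
Qed.

(** For |zeta| = 1 the quadratic term of [disk_form] disappears, so the disk becomes a
    half-plane. *)
Lemma disk_form_unit zeta s :
  Cmod zeta = 1 -> disk_form zeta (- ((s + 1) / (RtoC 2 * zeta))) = - Re s.
Proof.
  intros Hz. unfold disk_form; rewrite Hz.
  assert (Hz0 : zeta <> RtoC 0) by (apply Cmod_gt_0; lra).
  assert (H2 : RtoC 2 <> RtoC 0) by (apply Re_nonzero; simpl; lra).
  replace (zeta * - ((s + 1) / (RtoC 2 * zeta)))%C with (RtoC (- / 2) * (s + 1))%C.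
  - destruct s as [x y]; simpl. field.
  - rewrite RtoC_opp, RtoC_inv by lra. field; tauto.
Qed.

Lemma cayley_surjective zeta z :
  Cmod zeta = 1 -> disk z -> exists s, 0 < Re s /\ z = cayley zeta s.
Proof.
  intros Hz Hd.
  assert (Hz0 : zeta <> RtoC 0) by (apply Cmod_gt_0; lra).
  assert (H2 : RtoC 2 <> RtoC 0) by (apply Re_nonzero; simpl; lra).
  assert (Hne : (z - zeta)%C <> RtoC 0).
  { intros E. unfold disk in Hd.
    replace z with zeta in Hd; [lra|].
    transitivity (z - (z - zeta))%C; [ring|rewrite E; ring]. }
  set (s := (- (RtoC 2 * zeta / (z - zeta)) - 1)%C).
  assert (Es : (- ((s + 1) / (RtoC 2 * zeta)))%C = (/ (z - zeta))%C).
  { unfold s; field; tauto. }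
  assert (Hs : 0 < Re s).
  { pose proof (disk_form_unit zeta s Hz) as E. rewrite Es in E.
    assert (Hi : (/ (z - zeta))%C <> RtoC 0).
    { intros E2. apply Hne. transitivity (/ / (z - zeta))%C; [field; exact Hne|].
      apply (f_equal Cmod) in E2. rewrite Cmod_inv, Cmod_0 in E2 by exact Hne.
      apply Cmod_gt_0, Rinv_0_lt_compat in Hne. lra. }
    assert (disk_form zeta (/ (z - zeta)) < 0); [|lra].
    apply disk_form_disk; [exact Hi|].
    replace (zeta + / / (z - zeta))%C with z; [exact Hd|]. field; exact Hne. }
  exists s; split; [exact Hs|].
  rewrite cayley_reciprocal, Es; [|exact Hz0|apply Re_nonzero; unfold Re in *; simpl in *; lra].
  field; exact Hne.
Qed.

Lemma cayley_injective zeta s s' :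
  zeta <> RtoC 0 -> 0 < Re s -> 0 < Re s' -> cayley zeta s = cayley zeta s' -> s = s'.
Proof.
  intros Hz Hs Hs' E.
  assert (H1 : (s + 1)%C <> RtoC 0) by (apply Re_nonzero; unfold Re in *; simpl; lra).
  assert (H2 : (s' + 1)%C <> RtoC 0) by (apply Re_nonzero; unfold Re in *; simpl; lra).
  assert (H3 : RtoC 2 <> RtoC 0) by (apply Re_nonzero; simpl; lra).
  rewrite !cayley_reciprocal in E by assumption.
  transitivity (s' + ((zeta + / - ((s + 1) / (RtoC 2 * zeta))) -
     (zeta + / - ((s' + 1) / (RtoC 2 * zeta)))) * ((s + 1) * (s' + 1)) / (RtoC 2 * zeta))%C;
    [field; tauto|rewrite E; field; tauto].
Qed.

Lemma parabolic_cayley_translation phi :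
  parabolic phi -> disk_self_map phi -> ~ disk_automorphism phi ->
  exists zeta a : C, Cmod zeta = 1 /\ 0 < Re a /\
    forall s, 0 < Re s -> phi (Some (cayley zeta s)) = Some (cayley zeta (s + a)).
Proof.
  intros Hpar Hself Hnaut.
  destruct (parabolic_reciprocal_translation phi Hpar Hself) as [zeta [kappa [Hk Hphi]]].
  assert (Hstep : forall q, disk_form zeta q < 0 -> disk_form zeta (q + kappa) < 0).
  { intros q Hq. pose proof (disk_form_neg_nonzero _ _ Hq) as Hq0.
    destruct (Hphi q Hq0) as [HS HN].
    apply disk_form_disk in Hq; [|exact Hq0].
    destruct (Hself _ Hq) as [w [Hw E]].
    destruct (Ceq_dec (q + kappa) 0) as [E0|Hne].
    - rewrite HN in E by exact E0; discriminate.
    - rewrite HS in E by exact Hne. injection E as E.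
      apply disk_form_disk; [exact Hne|]. now rewrite E. }
  pose proof (translation_invariant_unit zeta kappa Hk Hstep) as Hz.
  assert (Hz0 : zeta <> RtoC 0) by (apply Cmod_gt_0; lra).
  assert (H2 : RtoC 2 <> RtoC 0) by (apply Re_nonzero; simpl; lra).
  (* Read off from q = -(s + 1) / (2 zeta): adding kappa to q adds this to s. *)
  set (a := (- (RtoC 2 * zeta * kappa))%C).
  assert (Eq : forall s, (- ((s + 1) / (RtoC 2 * zeta)) + kappa)%C =
             (- ((s + a + 1) / (RtoC 2 * zeta)))%C).
  { intros s; unfold a; field; tauto. }
  assert (Hpos : forall s, 0 < Re s -> 0 < Re (s + a)).
  { intros s Hs. pose proof (Hstep (- ((s + 1) / (RtoC 2 * zeta)))%C) as H.
    rewrite Eq, !disk_form_unit in H by exact Hz. lra. }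
  (* Points s = e > 0 arbitrarily close to the boundary must stay in the half-plane. *)
  assert (Ha : 0 <= Re a).
  { apply le_epsilon; intros e He.
    specialize (Hpos (RtoC e) He). unfold Re in *; simpl in *; lra. }
  assert (Hne : forall s, 0 < Re s -> (s + 1)%C <> RtoC 0).
  { intros s Hs; apply Re_nonzero; unfold Re in *; simpl; lra. }
  assert (Hnz : forall s, 0 < Re s -> (- ((s + 1) / (RtoC 2 * zeta)))%C <> RtoC 0).
  { intros s Hs. apply (disk_form_neg_nonzero zeta). rewrite disk_form_unit by exact Hz. lra. }
  assert (Hmap : forall s, 0 < Re s -> phi (Some (cayley zeta s)) = Some (cayley zeta (s + a))).
  { intros s Hs.
    rewrite !cayley_reciprocal by (auto; apply Hne; now apply Hpos).
    rewrite <- Eq. apply Hphi; [now apply Hnz|]. rewrite Eq; now apply Hnz, Hpos. }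
  exists zeta, a; split; [exact Hz|split; [|exact Hmap]].
  (* If Re a = 0, translation by -a also preserves the half-plane, so phi is a bijection of the
     disk. *)
  destruct Ha as [Ha|Ha]; [exact Ha|exfalso; apply Hnaut].
  split; [exact Hself|split].
  - intros z1 z2 D1 D2 E.
    destruct (cayley_surjective zeta z1 Hz D1) as [s1 [P1 ->]].
    destruct (cayley_surjective zeta z2 Hz D2) as [s2 [P2 ->]].
    rewrite !Hmap in E by assumption.
    assert (E' : cayley zeta (s1 + a) = cayley zeta (s2 + a)) by congruence.
    apply cayley_injective in E'; [|exact Hz0|now apply Hpos|now apply Hpos].
    f_equal. transitivity (s1 + a - a)%C; [ring|rewrite E'; ring].
  - intros w Dw.
    destruct (cayley_surjective zeta w Hz Dw) as [s [Ps ->]].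
    assert (Psa : 0 < Re (s - a)) by (change (0 < Re s + - Re a); lra).
    exists (cayley zeta (s - a)); split; [now apply cayley_disk|].
    rewrite Hmap by exact Psa. do 2 f_equal. ring.
Qed.

Theorem theorem3p7 (phi : sphere -> sphere)
  (Hparabolic : parabolic phi)
  (Hself : disk_self_map phi)
  (Hnaut : ~ disk_automorphism phi) :
  forall (lambda : C) (nu : R),
    ~ recurrent nu (scaled lambda (composition_operator phi)).
Proof.
  intros lambda nu.
  destruct (parabolic_cayley_translation phi Hparabolic Hself Hnaut) as [zeta [a [Hz [Ha Hphi]]]].
  now apply (cayley_translation_not_recurrent phi zeta a).
Qed.
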